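(* For each integer $n \geq 2$, the number $n^6 \times 7.65713 \times 10^{18}$ is a valid value for $C_n$; that is, every prime power $q > n^6 \times 7.65713 \times 10^{18}$ satisfies $q \in Q_n$. For $n = 3, 4, 5$ this value can be reduced to $4.426 \times 10^8$, $7.867 \times 10^8$ and $1.23 \times 10^9$, respectively; that is, for every prime power $q$: if $q > 4.426 \times 10^8$ then $q \in Q_3$; if $q > 7.867 \times 10^8$ then $q \in Q_4$; and if $q > 1.23 \times 10^9$ then $q \in Q_5$.
   Context: For a prime power $q$, $\mathbb{F}_q$ is the finite field of order $q$ and $\mathbb{F}_q^*$ its (cyclic) multiplicative group; a generator of $\mathbb{F}_q^*$ is called a primitive element of $\mathbb{F}_q$. For a rational function $f(x) \in \mathbb{F}_q(x)$ and $\alpha \in \mathbb{F}_q$, the pair $(\alpha, f(\alpha))$ is a primitive pair in $\mathbb{F}_q$ if $\alpha$ is not a pole of $f$ and both $\alpha$ and $f(\alpha)$ are primitive elements of $\mathbb{F}_q$. Rational functions are written in lowest terms $f = f_1/f_2$ with $f_1, f_2 \in \mathbb{F}_q[x]$ nonzero coprime polynomials, $f_2$ monic, of degrees $n_1$ and $n_2$ respectively; the degree of $f$ is defined to be $n_1 + n_2$. The function $f$ is called exceptional if it is of the form $f(x) = c\,x^j g(x)^d$ for some integer $j$ (positive, negative or zero), some integer $d > 1$ dividing $q-1$, some $c \in \mathbb{F}_q^*$ and some rational function $g(x) \in \mathbb{F}_q(x)$. For each positive integer $n$, $R_n$ (over $\mathbb{F}_q$) is the set of non-exceptional rational functions $f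 = f_1/f_2$ (with $f_1, f_2 \in \mathbb{F}_q[x]$ nonzero coprime polynomials of degrees $n_1$ and $n_2$ respectively, and $f_2$ monic) of degree $n = n_1 + n_2$ with $n_1 \geq n_2$. $Q_n$ is the set of prime powers $q$ such that for each $f \in R_n$ over $\mathbb{F}_q$ there exists $\alpha \in \mathbb{F}_q$ for which $(\alpha, f(\alpha))$ is a primitive pair in $\mathbb{F}_q$. A number $C > 0$ is a valid value for $C_n$ if every prime power $q > C$ lies in $Q_n$. *)

(* Defs.v *)
From HB Require Import structures.
From mathcomp Require Import all_boot all_order all_fingroup all_algebra.
From mathcomp Require Import cyclic.

Set Implicit Arguments.
Unset Strict Implicit.
Unset Printing Implicit Defensive.

Import Order.TTheory GRing.Theory Num.Theory.
Local Open Scope ring_scope.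

Definition prime_power (q : nat) : Prop :=
  exists p k : nat, [/\ prime p, (0 < k)%N & q = (p ^ k)%N].

Definition primitive_element (F : finFieldType) (a : F) : Prop :=
  exists2 u : {unit F}, val u = a & generator [set: {unit F}] u.

Definition ratfun (F : finFieldType) : Type := {fraction {poly F}}.

(* [{fraction _}] carries no canonical numerator and denominator, so this is
   a relation; for a given nonzero [f] exactly one pair satisfies it. *)
Definition lowest_terms (F : finFieldType) (f : ratfun F) (f1 f2 : {poly F}) :
    Prop :=
  [/\ f1 != 0, f2 \is monic, coprimep f1 f2
    & f = tofrac f1 / tofrac f2 :> {fraction {poly F}}].

Definition exceptional (F : finFieldType) (f : ratfun F) : Prop :=
  exists (c : F) (j : int) (g : {fraction {poly F}}) (d : nat),
    [/\ c != 0, (1 < d)%N, (d %| #|F|.-1)%N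
      & f = tofrac c%:P * tofrac 'X ^ j * g ^+ d :> {fraction {poly F}}].

Definition primitive_pair (F : finFieldType) (f : ratfun F) (a : F) : Prop :=
  exists f1 f2 : {poly F},
    [/\ lowest_terms f f1 f2,
        f2.[a] != 0,
        primitive_element a
      & primitive_element (f1.[a] / f2.[a])].

Definition in_R (F : finFieldType) (n : nat) (f : ratfun F) : Prop :=
  ~ exceptional f /\
  exists f1 f2 : {poly F},
    [/\ lowest_terms f f1 f2,
        ((size f1).-1 + (size f2).-1)%N = n
      & ((size f2).-1 <= (size f1).-1)%N].

(* The field of order [q] is unique up to isomorphism, so [F_q] is rendered by
   quantifying over all finite fields of cardinality [q]. *)
Definition in_Q (n q : nat) : Prop :=
  prime_power q /\
  forall F : finFieldType, #|F| = q ->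
    forall f : ratfun F, in_R n f -> exists a : F, primitive_pair f a.

Definition valid_C (K : realFieldType) (n : nat) (C : K) : Prop :=
  0 < C /\ forall q : nat, prime_power q -> C < q%:R -> in_Q n q.

(* Main.v *)
Require Import Defs.
From HB Require Import structures.
From mathcomp Require Import all_boot all_order all_algebra.
From mathcomp Require Import all_fingroup all_solvable all_field.
From mathcomp Require Import zify ring lra.

Set Implicit Arguments.
Unset Strict Implicit.
Unset Printing Implicit Defensive.

Import Order.TTheory GRing.Theory Num.Theory.
Local Open Scope ring_scope.

(** Put [q = #|F|] and [N = q - 1], and let [n] be the degree of [f].  Detecting
primitivity of [x] and of [f(x)] by multiplicative characters reduces the
theorem to one estimate: for characters of orders dividing [N], not both
trivial, the sum of [chi1(x) chi2(f(x))] over [F] has modulus at most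
[n sqrt q].  When [chi2] is nontrivial this is the Weil bound for the character
of order [d] evaluated at a polynomial [P = X^a f1^b f2^c], all of whose zeros
are zeros of [X f1 f2], a polynomial of degree [n + 1]; [f] being
non-exceptional is what prevents [P] from being degenerate for that character
([nondegenerate_twist]).

The Weil bound ([weil_bound]) is obtained in two halves.  The L-function of the
character, [sum_g chi(Res(g, P)) T^(deg g)] over monic [g], is a polynomial of
degree less than [deg (X f1 f2)] ([lcoef_eq0]).  Its coefficients satisfy
Newton's identities with respect to the norm character sums over the fields
with [q^s] elements ([newton_lcoef]), so that each of these sums is minus the
sum of the [s]-th powers of the reciprocal roots.  Hence it suffices to bound
the sums by [C q^(s/2)] for even [s], with any constant [C]: this forces every
reciprocal root to have modulus at most [sqrt q], and [s = 1] gives the sharp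
constant ([l_function_bound]).  The crude bound comes from counting, over a
field with [r^2] elements, the points where [P^((r^2-1)/d)] takes a given value
([stepanov_count]).  Because [r^2] is a square, the auxiliary polynomial can be
chosen so that its [r]-th power agrees with a vanishing expression at all these
points, and no derivatives are needed.  Its own non-vanishing comes from the
irreducibility of [P Y^d - c] over the rational function field, in the form of
a nonzero resultant of small degree ([powers_independent_mod]).

The passage from character sums to primitive pairs is the prime sieve
([sieve_exists]): the primes dividing [N] are split into a set [L], treated
exactly at a cost of [W^2] characters with [W = 2^|L|], and a set [ps] of [s]
primes whose contributions are subtracted.  With
[delta = 1 - 2 sum_(p in ps) 1/p > 0] a primitive pair exists as soon as
[n W^2 ((2s - 1) / delta + 2) <= sqrt q].

For the general constant no prime is sieved.  Then [n W^2 <= sqrt q] follows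
from [W^6 <= N prod_(p < 64) 64/p]: each prime factor [p] of [N] contributes 64
to [W^6] and at least [p] to [N], so that only the 18 primes below 64 can
contribute a ratio above 1.  The square of this product is just below
[7.65713 * 10^18].  For [n = 3, 4, 5] the number [om] of prime factors of [N]
decides: at most 6 primes need no sieving, 7 to 11 are treated with the four
smallest primes in [L], 12 to 18 with the six smallest, and 19 or more force
[q] above the general constant.  The critical case is [om = 9], where
[256 ((2 * 5 - 1) / delta + 2)] is about 7012: the three stated values are
essentially the squares of 7012 n. *)

(** * Kummer polynomials over a rational function field *)

(** The norm of the class of ['X] in [L[X]/(D)]: the companion matrix [A] of [D]
    satisfies [A^d = a], and taking determinants gives [(det A)^d = a^(deg D)].
    This replaces a splitting field in the study of the factors of [X^d - a]. *)
Lemma dvdp_binomial_norm (L : fieldType) (a : L) d (D : {poly L}) :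
  (1 < size D)%N -> D %| 'X^d - a%:P -> exists b, b ^+ d = a ^+ (size D).-1.
Proof.
wlog Dmon : D / D \is monic => [hw sD Dd | sD /Pdiv.Field.dvdpP [q qD]].
  have lD : lead_coef D != 0 by rewrite lead_coef_eq0 -size_poly_gt0 ltnW.
  have := hw ((lead_coef D)^-1 *: D); rewrite size_scale ?invr_eq0 // dvdpZl ?invr_eq0 //.
  by apply=> //; rewrite monicE lead_coefZ mulVf.
case E: (size D).-1 => [|n]; first by move: E sD; case: (size D) => [|[]].
have := companionmxK Dmon; move: (companionmx D); rewrite E => A hA.
have := Cayley_Hamilton A; rewrite hA => hD.
have: horner_mx A ('X^d - a%:P) = 0 by rewrite qD rmorphM /= hD mulr0.
rewrite rmorphB rmorphXn /= horner_mx_X horner_mx_C => /subr0_eq hAd.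
have <-: \det (A ^+ d) = a ^+ n.+1 by rewrite hAd det_scalar.
exists (\det A).
by elim: d {qD hAd} => [|d IH]; rewrite ?expr0 ?det1 // !exprS IH -det_mulmx.
Qed.

Lemma size_det_row (R : comNzRingType) n (M : 'M[{poly R}]_n) (b : 'I_n -> nat) :
  (forall i j, (size (M i j) <= (b i).+1)%N) ->
  (size (\det M) <= (\sum_i b i).+1)%N.
Proof.
move=> hM; rewrite /determinant.
apply: (leq_trans (size_sum _ _ _)); apply/bigmax_leqP => s _.
rewrite mulr_sign; case: ifP => _; rewrite ?size_polyN.
all: apply: (leq_trans (size_poly_prod_leq _ _)).
all: rewrite leq_subLR; apply: (@leq_trans (\sum_(i < n) (b i).+1).+1).
1,3: by rewrite ltnS; apply: leq_sum => i _.
all: rewrite addnS ltnS -sum1_card -big_split /=.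
all: by apply: leq_sum => i _; rewrite add1n.
Qed.

Lemma size_resultant (R : comNzRingType) (u v : {poly {poly R}}) a b :
  (forall i, (size (u`_i)%R <= a.+1)%N) -> (forall i, (size (v`_i)%R <= b.+1)%N) ->
  (size (resultant u v) <= ((size v).-1 * a + (size u).-1 * b).+1)%N.
Proof.
move=> hu hv; rewrite /resultant.
apply: leq_trans (size_det_row (b := fun i => match split i with inl _ => a | inr _ => b
  end) _) _.
  move=> i j; rewrite Sylvester_mxE.
  by case: (split i) => k; case: (k <= j)%N; rewrite ?mulr1n ?mulr0n ?size_poly0.
rewrite ltnS big_split_ord /=.
rewrite (eq_bigr (fun=> a)) => [|i _]; last by rewrite (unsplitK (inl i)).
rewrite [X in (_ + X)%N](eq_bigr (fun=> b)) => [|i _]; last by rewrite (unsplitK (inr i)).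
by rewrite !sum_nat_const !card_ord.
Qed.

Lemma fraction_quotient (R : idomainType) (x : {fraction R}) :
  exists u v : R, v != 0 /\ x = tofrac u / tofrac v.
Proof.
elim/quotP: x => y _; exists (frac y).1, (frac y).2.
have d0 := denom_ratioP y; split=> //.
apply: (canRL (mulfK _)); first by rewrite tofrac_eq0.
unlock FracField.tofrac; rewrite -[LHS]FracField.pi_mul; apply/eqmodP => /=.
rewrite FracField.equivfE /FracField.mulf !numden_Ratio ?oner_eq0 ?mulr1 //.
by rewrite mulrC.
Qed.

Lemma mup_exp (K : fieldType) (P : {poly K}) z j : P != 0 -> mup z (P ^+ j) = (j * mup z P)%N.
Proof.
move=> P0; elim: j => [|j IH]; first by rewrite expr0 mul0n mupNroot // root1.
by rewrite exprS mupM ?expf_neq0 // IH mulSn.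
Qed.

Lemma mup_const (K : fieldType) (c : K) z : c != 0 -> mup z c%:P = 0%N.
Proof. by move=> c0; rewrite mupNroot // rootC. Qed.

(** Over an algebraically closed field this says that [P] is not, up to a constant,
    a [k]-th power for any divisor [k > 1] of [d]: equivalently [Y^d - P] is
    irreducible over the rational functions. *)
Definition nondegenerate (K : fieldType) (P : {poly K}) (d : nat) :=
  forall j, (0 < j < d)%N -> exists z, ~~ (d %| j * mup z P)%N.

Lemma dvdp_map_binomial (R : idomainType) (L : fieldType) (f : {rmorphism R -> L})
    (P c : R) d (D : {poly R}) :
  injective f -> P != 0 -> D %| P%:P * 'X^d - c%:P ->
  map_poly f D %| 'X^d - (f c / f P)%:P.
Proof.
move=> finj P0 /Pdiv.Idomain.dvdpP [[k w] /= k0 kE].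
have f0 x : (f x == 0) = (x == 0) by rewrite -(inj_eq finj) rmorph0.
have E2 : (f k * f P) *: ('X^d - (f c / f P)%:P) = map_poly f w * map_poly f D.
  have -> : map_poly f w * map_poly f D = map_poly f (w * D) by rewrite rmorphM.
  have hE : map_poly f (P%:P * 'X^d - c%:P) = (f P)%:P * 'X^d - (f c)%:P.
    by rewrite raddfB /= mul_polyC map_polyC map_polyZ map_polyXn mul_polyC.
  rewrite -kE map_polyZ hE.
  rewrite -scalerA; congr (_ *: _); rewrite scalerBr -!mul_polyC; congr (_ - _).
  by rewrite -polyCM mulrC divfK ?f0.
have fkP : f k * f P != 0 by rewrite mulf_neq0 ?f0.
by rewrite -(dvdpZr _ _ fkP) E2 dvdp_mull.
Qed.

(** A common factor of degree [j < d] would turn [(c / P)^j] into a [d]-th power of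
    a rational function by [dvdp_binomial_norm], so that [d] would divide [j]
    times each multiplicity of [P]. *)
Lemma resultant_kummer_neq0 (K : fieldType) (P : {poly K}) c d (u : {poly {poly K}}) :
  P != 0 -> c != 0 -> (0 < d)%N -> nondegenerate P d ->
  u != 0 -> (size u <= d)%N ->
  resultant u (P%:P * 'X^d - c%:P%:P) != 0.
Proof.
move=> P0 c0 d0 ndP u0 sud; set E := (_ - _).
apply: contraT; rewrite negbK resultant_eq0; set D := gcdp u E => sD.
have sDd : (size D <= d)%N by apply: leq_trans sud; apply: dvdp_leq (dvdp_gcdl _ _).
have DE : D %| E by apply: dvdp_gcdr.
pose f : {rmorphism {poly K} -> {fraction {poly K}}} := @FracField.tofrac _.
have finj : injective f by move=> x y /eqP; rewrite tofrac_eq => /eqP.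
have f0 x : (f x == 0) = (x == 0) by rewrite tofrac_eq0.
have := @dvdp_binomial_norm _ (f c%:P / f P) d (map_poly f D).
rewrite size_map_inj_poly ?rmorph0 // sD => /(_ isT).
case=> [|b].
  exact: dvdp_map_binomial.
have [uu [v [v0 ->]]] := fraction_quotient b.
rewrite expr_div_n expr_div_n => /eqP.
rewrite eqr_div ?expf_neq0 ?f0 // -!rmorphXn -!rmorphM /= tofrac_eq => /eqP hE.
set j := (size D).-1 in hE.
have uu0 : uu != 0.
  have : (c ^+ j)%:P * v ^+ d != 0 by rewrite mulf_neq0 ?expf_neq0 ?polyC_eq0 ?expf_neq0.
  by apply: contraNneq => h; rewrite -hE h expr0n gtn_eqF // mul0r.
have jd : (0 < j < d)%N by rewrite /j; case: (size D) sD sDd => [|[]].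
have [z] := ndP j jd; apply: contraNT => _.
have hm : (d * mup z uu + j * mup z P = d * mup z v)%N.
  rewrite -!mup_exp // -mupM ?expf_neq0 // hE.
  by rewrite mupM ?polyC_eq0 ?expf_neq0 // mup_const ?expf_neq0.
by rewrite -(dvdn_addr _ (dvdn_mulr (mup z uu) (dvdnn d))) hm dvdn_mulr.
Qed.

(** * The Stepanov-Bombieri point count *)

Lemma exprBn_pnat (R : comNzRingType) (x y : R) n :
  [pchar R].-nat n -> (x - y) ^+ n = x ^+ n - y ^+ n.
Proof.
move=> hn; apply: (addIr (y ^+ n)); rewrite subrK -exprDn_pchar //.
by rewrite subrK.
Qed.

Lemma pnat_poly (R : nzRingType) n :
  [pchar R].-nat n -> [pchar {poly R}].-nat n.
Proof. by rewrite (eq_pnat _ (@pchar_poly R)). Qed.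

(** [P - P(b)] vanishes at [b] and [r] is a power of the characteristic. *)
Lemma dvdp_frobenius_sub (K : fieldType) (P : {poly K}) r b :
  [pchar K].-nat r -> ('X - b%:P) ^+ r %| P ^+ r - (P.[b] ^+ r)%:P.
Proof.
move=> hr; rewrite polyC_exp -exprBn_pnat ?pnat_poly //.
by apply: dvdp_exp2r; rewrite dvdp_XsubCl /root !hornerE subrr.
Qed.

(** Here [g = P^e] satisfies [P g^d = P^r], which modulo [(X - b)^r] is the constant
    [c = P(b)^r]; so [g] behaves like a [d]-th root of [c / P].  The resultant in
    [Y] of [sum_i a_i Y^i] and [P Y^d - c] lies in the ideal they generate, hence
    vanishes modulo [(X - b)^r]; but its degree is below [r], so it is zero,
    contrary to [resultant_kummer_neq0]. *)
Lemma powers_independent_mod (K : fieldType) (P : {poly K}) d e r b A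
    (a : 'I_d -> {poly K}) :
  [pchar K].-nat r -> r = (d * e).+1 -> nondegenerate P d -> P.[b] != 0 ->
  (0 < A)%N -> (d * A + d * (size P).-1 <= r)%N ->
  (forall i, (size (a i) <= A)%N) ->
  ('X - b%:P) ^+ r %| \sum_i a i * P ^+ (i * e) -> forall i, a i = 0.
Proof.
move=> hr rE ndP Pb A0 hA sa.
have P0 : P != 0 by apply: contraNneq Pb => ->; rewrite horner0.
set u : {poly {poly K}} := \sum_i (a i)%:P * 'X^i.
have cu (i : 'I_d) : u`_i = a i.
  rewrite coef_sum (bigD1 i) //= coefCM coefXn eqxx mulr1 big1 ?addr0 // => j ji.
  by rewrite coefCM coefXn eq_sym val_eqE (negPf ji) mulr0.
have su : (size u <= d)%N.
  apply/leq_sizeP => j dj; rewrite coef_sum big1 // => i _.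
  by rewrite coefCM coefXn gtn_eqF ?mulr0 // (leq_trans (ltn_ord i) dj).
have ug : u.[P ^+ e] = \sum_i a i * P ^+ (i * e).
  rewrite horner_sum; apply: eq_bigr => i _.
  by rewrite !hornerE mulnC exprM.
rewrite -ug => hdv.
have [u0|u0] := eqVneq u 0; first by move=> i; rewrite -cu u0 coef0.
have d0 : (0 < d)%N by case: (d) su u0 => [|//]; rewrite leqn0 size_poly_eq0 => ->.
have su1 i : (size (u`_i)%R <= A.-1.+1)%N.
  rewrite prednK //; have [di|di] := ltnP i d; first by rewrite (cu (Ordinal di)) sa.
  by rewrite nth_default ?size_poly0 // (leq_trans su).
have [/size1_polyC u1|u1] := leqP (size u) 1.
  have u00 : u`_0 != 0 by rewrite -polyC_eq0 -u1.
  move: hdv; rewrite u1 hornerC => /(dvdp_leq u00); rewrite size_exp_XsubC => h.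
  have := leq_trans h (su1 0%N); nia.
set c := P.[b] ^+ r.
have c0 : c != 0 by rewrite expf_neq0.
have := resultant_kummer_neq0 P0 c0 d0 ndP u0 su.
set E := (_ - _) => R0.
have sE : size E = d.+1.
  rewrite /E size_polyDl; first by rewrite size_Cmul // size_polyXn.
  by rewrite size_polyN size_Cmul // size_polyXn size_polyC polyC_eq0 c0.
have sE1 i : (size (E`_i)%R <= (size P).-1.+1)%N.
  rewrite prednK ?size_poly_gt0 // /E coefB coefCM coefXn coefC.
  case: eqP => [->|_]; rewrite ?mulr1 ?mulr0.
    by rewrite gtn_eqF // subr0.
  case: eqP => _; rewrite sub0r size_polyN ?size_poly0 // size_polyC c0.
  by rewrite size_poly_gt0.
have [|[U V] /= _ hUV] := resultant_in_ideal u1 (_ : (1 < size E)%N).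
  by rewrite sE.
have := congr1 (fun q => q.[P ^+ e]) hUV.
rewrite hornerC hornerD !hornerM => hR.
have : ('X - b%:P) ^+ r %| resultant u E.
  rewrite hR dvdp_add ?dvdp_mull //.
  suff -> : E.[P ^+ e] = P ^+ r - c%:P by exact: dvdp_frobenius_sub.
  by rewrite !hornerE -exprM mulnC -exprS rE.
move=> /(dvdp_leq R0); rewrite size_exp_XsubC => h1.
have := leq_trans h1 (size_resultant su1 sE1); rewrite sE /=.
move: su u1 hA; clear -d0 A0; move: (size u) (size P).-1 => s m.
case: A A0 => // A _ /= h1 h2 h3.
nia.
Qed.

(** The lowest power of [(X - b)^r] is isolated by reducing modulo [(X - b)^r]; the
    rest is divisible by [(X - b)^r] and induction applies. *)
Lemma independent_combination (K : fieldType) (P : {poly K}) d e r b A k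
    (a : 'I_d -> nat -> {poly K}) :
  [pchar K].-nat r -> r = (d * e).+1 -> nondegenerate P d -> P.[b] != 0 ->
  (0 < A)%N -> (d * A + d * (size P).-1 <= r)%N ->
  (forall i l, (size (a i l) <= A)%N) ->
  \sum_(l < k) \sum_i a i l * ('X - b%:P) ^+ (l * r) * P ^+ (i * e) = 0 ->
  forall i l, (l < k)%N -> a i l = 0.
Proof.
move=> hr rE ndP Pb A0 hA; elim: k a => [|k IH] a sa; first by [].
rewrite big_ord_recl /=.
set S := \sum_(l < k) _ => h0.
have hS : S = ('X - b%:P) ^+ r *
   \sum_(l < k) \sum_i a i l.+1 * ('X - b%:P) ^+ (l * r) * P ^+ (i * e).
  rewrite /S mulr_sumr; apply: eq_bigr => l _; rewrite mulr_sumr.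
  by apply: eq_bigr => i _; rewrite /bump /= add1n mulSn exprD; ring.
have a0 : forall i, a i 0%N = 0.
  apply: (powers_independent_mod hr rE ndP Pb A0 hA) => //.
  under eq_bigr do rewrite -[a _ _](mulr1) -(expr0 ('X - b%:P)) -[0%N](mul0n r).
  by move/eqP: h0; rewrite addr_eq0 => /eqP ->; rewrite dvdpNr hS dvdp_mulr.
move: h0; rewrite big1 ?add0r => [|i _]; last by rewrite a0 !mul0r.
rewrite hS => /eqP; rewrite mulf_eq0 expf_eq0 polyXsubC_eq0 andbF /= => /eqP h1.
move=> i [//|l] hl; exact: (IH (fun i l => a i l.+1)).
Qed.

Lemma poly_dependency (K : fieldType) (I : finType) (B : I -> {poly K}) n :
  (forall i, (size (B i) <= n)%N) -> (n < #|I|)%N ->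
  exists v : I -> K, (exists i, v i != 0) /\ \sum_i (v i)%:P * B i = 0.
Proof.
move=> sB hn.
pose M : 'M[K]_(#|I|, n) := \matrix_(i, j) (B (enum_val i))`_j.
have : kermx M != 0.
  rewrite kermx_eq0 /row_free; apply: contraTN hn => /eqP <-.
  by rewrite -leqNgt rank_leq_col.
case/rowV0Pn => w /sub_kermxP wM w0.
exists (fun i => w 0 (enum_rank i)); split.
  have /rV0Pn [j wj] := w0.
  by exists (enum_val j); rewrite enum_valK.
apply/polyP => j; rewrite coef0 coef_sum.
have [jn|jn] := ltnP j n; last first.
  by rewrite big1 // => i _; rewrite coefCM nth_default ?mulr0 // (leq_trans (sB i)).
have := congr1 (fun N : 'rV_n => N 0 (Ordinal jn)) wM; rewrite !mxE => w0j.
rewrite (reindex (@enum_val I predT)) /=; last exact: onW_bij (@enum_val_bij I).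
transitivity (\sum_j0 w 0 j0 * M j0 (Ordinal jn)); last exact: w0j.
by apply: eq_bigr => l _; rewrite coefCM enum_valK mxE.
Qed.

Lemma expr_sum_pnat (R : comNzRingType) (I : Type) (s : seq I) (F : I -> R) n :
  [pchar R].-nat n -> (\sum_(i <- s) F i) ^+ n = \sum_(i <- s) F i ^+ n.
Proof.
move=> hn; elim: s => [|i s IH]; last by rewrite !big_cons exprDn_pchar // IH.
by rewrite !big_nil expr0n gtn_eqF //; case/andP: hn.
Qed.

Lemma closed_field_root (K : closedFieldType) n (c : K) :
  (0 < n)%N -> exists x, x ^+ n == c.
Proof.
move=> n0; have /closed_rootP [x] : size ('X^n - c%:P : {poly K}) != 1.
  by rewrite size_XnsubC // eqSS -lt0n.
by rewrite /root !hornerE subr_eq0; exists x.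
Qed.

Lemma size_polyX_exp_leq (K : fieldType) (P : {poly K}) n :
  (size (P ^+ n)%R <= (n * (size P).-1).+1)%N.
Proof. by have := size_poly_exp_leq P n; rewrite mulnC. Qed.

Lemma size_mul_leqS (R : nzRingType) (p q : {poly R}) a b :
  (size p <= a.+1)%N -> (size q <= b.+1)%N -> (size (p * q)%R <= (a + b).+1)%N.
Proof. by have := size_polyMleq p q; lia. Qed.

(** The points [x] of the field with [r^2] elements where [P(x)^((r^2-1)/d)] equals
    [zeta] are zeros of
    [R = sum_(i < d, n < k) a_(i,n) (X - b)^(n r) P^(i e)], with [deg a_(i,n) < A].
    At such points [R(x)^r] equals, up to a nonzero factor, the value of
    [sum zeta^i a'_(i,n)(X^r) (X - b)^n P^((d-1-i)e)], where [a'] has the [r]-th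
    powers of the coefficients of [a].  The latter polynomial has degree about
    [A r], so linear algebra produces [a] making it vanish identically as soon
    as [d k A] exceeds that; [R] itself is nonzero by
    [independent_combination], and its degree is about [k r].  Taking
    [A] and [k] close to [r / d] gives the bound [r^2 / d + O(r)]. *)
Lemma stepanov_count (K : closedFieldType) (P : {poly K}) d e r (zeta : K) (us : seq K) :
  [pchar K].-nat r -> r = (d * e).+1 -> nondegenerate P d -> (1 < d)%N ->
  (2 * (d * (size P).-1 + 2) <= r)%N -> zeta != 0 -> uniq us ->
  (forall x, x \in us -> x ^+ (r * r) = x /\ P.[x] ^+ (e * r.+1) = zeta) ->
  (d * size us <= r * r + (1 + d * (3 * (size P).-1 + 2)) * r)%N.
Proof.
move=> hr rE ndP d1 rbig z0 uus hus.
case: us uus hus => [|b us'] uus hus; first by rewrite muln0.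
set us := b :: us' in uus hus *.
have r0 : (0 < r)%N by rewrite rE.
have [bQ bz] := hus b (mem_head _ _).
have Pb : P.[b] != 0.
  apply: contraNneq z0 => h; rewrite -bz h expr0n; move: rbig; rewrite rE.
  by case: (e) => //; rewrite muln0; nia.
set m := (size P).-1 in rbig *.
have em : (2 * m < e)%N by move: rbig; rewrite rE; nia.
(* [A] is the largest size allowed by [independent_combination]; [k] exceeds
   [r / d] by enough for the unknowns to outnumber the equations. *)
pose A := (e - m)%N; pose k := (e + 2 * m + 2)%N.
have A0 : (0 < A)%N by rewrite /A; lia.
have dA : (d * A + d * m <= r)%N by rewrite /A -mulnDr subnK ?rE //; lia.
pose I : finType := ('I_k * ('I_d * 'I_A))%type.
pose B (t : I) : {poly K} :=
  (zeta ^+ t.2.1)%:P * 'X^(t.2.2 * r) * ('X - b%:P) ^+ t.1 * P ^+ ((d.-1 - t.2.1) * e).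
have hde : (d.-1 * e * m <= m * r)%N.
  rewrite [(m * r)%N]mulnC leq_mul2r rE; apply/orP; right.
  by apply: leq_trans (leqnSn _); rewrite leq_mul2r leq_pred orbT.
have [||v [[t0 v0] hv]] := @poly_dependency _ I B (A.-1 * r + k + d.-1 * e * m)%N.
- move=> [kk [i l]]; rewrite /B /=.
  have s1 : (size ((zeta ^+ i)%:P * 'X^(l * r))%R <= (l * r).+1)%N.
    by rewrite size_Cmul ?expf_neq0 // size_polyXn.
  have s2 := size_exp_XsubC kk b.
  have s3 := size_polyX_exp_leq P ((d.-1 - i) * e); rewrite -/m in s3.
  have s4 : (l * r <= A.-1 * r)%N by rewrite leq_mul2r; have := ltn_ord l; lia.
  have s5 : ((d.-1 - i) * e * m <= d.-1 * e * m)%N by rewrite !leq_mul2r leq_subr !orbT.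
  have s6 := ltn_ord kk.
  apply: leq_trans (size_mul_leqS (size_mul_leqS s1 (eq_leq s2)) s3) _; lia.
- rewrite !card_prod !card_ord.
  have h1 : (e * (d * m + 2) <= (m + 1) * (r - 1))%N.
    have -> : (e * (d * m + 2) = m * (d * e) + 2 * e)%N by lia.
    have -> : (r - 1 = d * e)%N by rewrite rE; lia.
    by rewrite mulnDl leq_add2l mul1n leq_mul2r d1 orbT.
  have [x hx] : exists x, r = (x + 2 + d * m)%N by exists (r - 2 - d * m)%N; lia.
  have h5 : ((m + 1) * r <= (2 * m + 2) * x)%N.
    have -> : ((2 * m + 2) * x = (m + 1) * (2 * x))%N by lia.
    by rewrite leq_mul2l; apply/orP; right; lia.
  have h3 : (d * A = r - 1 - d * m)%N by rewrite /A mulnBr rE; lia.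
  have h6 : (k * x = e * x + (2 * m + 2) * x)%N by rewrite /k; lia.
  have h7 : (e * r = e * x + e * (d * m + 2))%N by rewrite {1}hx; lia.
  have h8 : (A.-1 * r + m * r + r = e * r)%N.
    by rewrite -!mulnDl -mulSnr; congr muln; rewrite /A; lia.
  have h9 : (k * (d * A) = k * x + k)%N.
    by rewrite h3 -mulnSr; congr muln; lia.
  have h10 : ((m + 1) * (r - 1) < (m + 1) * r)%N.
    by rewrite ltn_mul2l; apply/andP; split; lia.
  move: h1 h5 h6 h7 h8 h10 hde.
  rewrite h9.
  lia.
have rt (c : K) : exists x, x ^+ r == c by exact: closed_field_root.
(* The linear system determines the [r]-th powers of the coefficients. *)
pose rv t := xchoose (rt (v t)).
have rvE t : rv t ^+ r = v t by apply/eqP; apply: (xchooseP (rt (v t))).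
pose a (i : 'I_d) (n : nat) : {poly K} :=
  if insub n is Some n' then \sum_(l < A) (rv (n', (i, l)))%:P * 'X^l else 0.
have aE i (n : 'I_k) : a i n = \sum_(l < A) (rv (n, (i, l)))%:P * 'X^l.
  by rewrite /a valK.
have sa i n : (size (a i n) <= A)%N.
  rewrite /a; case: insub => [n'|]; last by rewrite size_poly0.
  apply/leq_sizeP => j hj; rewrite coef_sum big1 // => l _.
  by rewrite coefCM coefXn gtn_eqF ?mulr0 // (leq_trans (ltn_ord l)).
pose R : {poly K} := \sum_(n < k) \sum_i a i n * ('X - b%:P) ^+ (n * r) * P ^+ (i * e).
have R0 : R != 0.
  apply: contraNneq v0 => h.
  have := independent_combination hr rE ndP Pb A0 dA sa h.
  case: t0 => n [i l] /= /(_ i n (ltn_ord n)); rewrite aE => /polyP/(_ l).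
  rewrite coef_sum coef0 (bigD1 l) //= coefCM coefXn eqxx mulr1 big1 ?addr0 => [h0|j jl].
    by rewrite -rvE h0 expr0n gtn_eqF.
  by rewrite coefCM coefXn eq_sym val_eqE (negPf jl) mulr0.
have sR : (size R <= A + k.-1 * r + d.-1 * e * m)%N.
  apply: leq_trans (size_sum _ _ _) _; apply/bigmax_leqP => n _.
  apply: leq_trans (size_sum _ _ _) _; apply/bigmax_leqP => i _.
  have s1 := sa i n.
  have s2 := size_exp_XsubC (n * r) b.
  have s3 := size_polyX_exp_leq P (i * e); rewrite -/m in s3.
  have s4 : (n * r <= k.-1 * r)%N by rewrite leq_mul2r; have := ltn_ord n; lia.
  have s5 : (i * e * m <= d.-1 * e * m)%N.
    by rewrite !leq_mul2r; rewrite -ltnS prednK ?ltn_ord ?orbT // ltnW.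
  rewrite -(prednK A0) in s1 *.
  apply: leq_trans (size_mul_leqS (size_mul_leqS s1 (eq_leq s2)) s3) _; lia.
have Ru : all (root R) us.
  apply/allP => x /hus [xQ xz]; rewrite /root.
  have Px : P.[x] != 0.
    apply: contraNneq z0 => h; rewrite -xz h expr0n muln_eq0 orbF.
    by case: (e) em.
  suff : R.[x] ^+ r * P.[x] ^+ (d.-1 * e) == 0.
    by rewrite mulf_eq0 !expf_eq0 (negPf Px) andbF orbF r0.
  have : (\sum_i (v i)%:P * B i).[x] == 0 by rewrite hv horner0.
  congr (_ == _).
  rewrite /R !horner_sum expr_sum_pnat // mulr_suml.
  under [RHS]eq_bigr => n _.
    rewrite horner_sum expr_sum_pnat // mulr_suml.
    under eq_bigr => i _.
      rewrite !hornerM aE horner_sum !exprMn expr_sum_pnat // !mulr_suml.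
      over.
    rewrite pair_bigA /=; over.
  rewrite pair_bigA /=; apply: eq_bigr => [[n [i l]]] _ /=.
  rewrite /B /= !hornerE /= !exprMn rvE -!exprM.
  have -> : (x - b) ^+ (n * r * r) = (x - b) ^+ n.
    by rewrite -mulnA mulnC exprM exprBn_pnat ?xQ ?bQ // pnatM hr.
  have -> : P.[x] ^+ (i * e * r) = zeta ^+ i / P.[x] ^+ (i * e).
    rewrite -xz -exprM; apply: (canRL (mulfK _)); first by rewrite expf_neq0.
    by rewrite -exprD; congr (_ ^+ _); lia.
  have -> : P.[x] ^+ (d.-1 * e) = P.[x] ^+ (i * e) * P.[x] ^+ ((d.-1 - i) * e).
    rewrite -exprD -mulnDl subnKC //; have := ltn_ord i; lia.
  have Pi : P.[x] ^+ (i * e) != 0 by rewrite expf_neq0.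
  by field.
have := max_poly_roots R0 Ru uus.
move: sR; rewrite /k /A; move: (size R) (size us) => sR su h1 h2.
have h3 : (su <= e + (e + 2 * m + 1) * r + d.-1 * e * m)%N by lia.
have h5 : (su <= e + (e + 3 * m + 1) * r)%N by lia.
have h6 : (d * su <= d * e + (d * e) * r + d * (3 * m + 1) * r)%N.
  by apply: leq_trans (_ : d * (e + (e + 3 * m + 1) * r) <= _)%N;
    rewrite ?leq_mul2l ?h5 ?orbT //; lia.
have h7 : (d * e = r - 1)%N by rewrite rE; lia.
have h8 : ((r - 1) * r + r = r * r)%N by rewrite -mulSnr subn1 prednK.
by rewrite h7 in h6; lia.
Qed.

(** * Power sums and reciprocal roots *)

(** Induction on the roots: multiplying by [1 - w X] changes the right-hand side by
    a telescoping sum. *)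
Lemma newton_power_sums (R : comNzRingType) (ws : seq R) n :
  let L := \prod_(w <- ws) (1 - w%:P * 'X) in
  n%:R * L`_n = \sum_(s < n) - (\sum_(w <- ws) w ^+ s.+1) * L`_(n - s.+1).
Proof.
elim: ws n => [|w ws IH] n /=.
  rewrite big_nil coef1 big1 => [|s _]; last by rewrite big_nil oppr0 mul0r.
  by case: n => [|n]; rewrite ?mul0r ?mulr0.
rewrite big_cons; set L := \prod_(w <- ws) _ in IH *.
have cL k : ((1 - w%:P * 'X) * L)`_k = L`_k - w * (if k is k'.+1 then L`_k' else 0).
  rewrite mulrBl mul1r -mulrA coefB coefCM coefXM; by case: k.
have tel k : \sum_(s < k) w ^+ s.+1 * ((1 - w%:P * 'X) * L)`_(k - s.+1)
   = w * (if k is k'.+1 then L`_k' else 0).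
  case: k => [|k]; first by rewrite big_ord0 mulr0.
  elim: k => [|k IHk]; first by rewrite big_ord1 cL subnn mulr0 subr0 expr1.
  rewrite big_ord_recl /= subn1 /= cL.
  under eq_bigr => s _ do rewrite /bump /= add1n exprS -mulrA subSS.
  by rewrite -mulr_sumr IHk expr1; ring.
under eq_bigr => s _ do rewrite big_cons opprD mulrDl mulNr.
rewrite big_split /= sumrN tel.
case: n => [|n]; first by rewrite big_ord0 mul0r mulr0 oppr0 addr0.
have -> : \sum_(i < n.+1) - (\sum_(w0 <- ws) w0 ^+ i.+1) * ((1 - w%:P * 'X) * L)`_(n.+1 - i.+1)
  = n.+1%:R * L`_n.+1 - w * (n%:R * L`_n).
  rewrite !IH mulr_sumr.
  rewrite [X in _ = X - _]big_ord_recr [LHS]big_ord_recr /=.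
  rewrite !subnn cL mulr0 subr0 -addrA [_ - \sum_(i < n) _]addrC addrA -sumrB.
  congr (_ + _); apply: eq_bigr => i _.
  by rewrite cL subSS -(subnSK (ltn_ord i)) /=; ring.
rewrite cL -natr1; ring.
Qed.

Lemma newton_unique (R : comNzRingType) (c d S T : nat -> R) :
  c 0 = 1 -> (forall n, c n = d n) ->
  (forall n, n%:R * c n = \sum_(s < n) S s.+1 * c (n - s.+1)%N) ->
  (forall n, n%:R * d n = \sum_(s < n) T s.+1 * d (n - s.+1)%N) ->
  forall s, S s.+1 = T s.+1.
Proof.
move=> c0 cd hS hT; elim/ltn_ind => s IH.
have := hS s.+1; rewrite cd hT !big_ord_recr /= subnn -!cd c0 !mulr1.
under [X in X + _ = _]eq_bigr => i _ do rewrite -IH // -cd.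
by move/addrI.
Qed.

Lemma closed_field_poly_normal1 (F : closedFieldType) (L : {poly F}) :
  L`_0 = 1 -> {ws : seq F | L = \prod_(w <- ws) (1 - w%:P * 'X) & (size ws < size L)%N}.
Proof.
move=> L0; have [zs Lzs] := closed_field_poly_normal L.
have Ln0 : L != 0 by apply: contra_eqN L0 => /eqP ->; rewrite coef0 eq_sym oner_eq0.
have lc0 : lead_coef L != 0 by rewrite lead_coef_eq0.
exists [seq z^-1 | z <- zs]; last first.
  by rewrite size_map Lzs size_scale // size_prod_XsubC.
have zn0 : all (fun z => z != 0) zs.
  apply/allP => z zzs; apply: contraTneq zzs => ->; rewrite -root_prod_XsubC.
  have : ~~ root L 0 by rewrite /root horner_coef0 L0 oner_eq0.
  by rewrite Lzs rootZ.
have [k Lk] : exists k, L = k *: \prod_(w <- [seq z^-1 | z <- zs]) (1 - w%:P * 'X).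
  rewrite Lzs big_map; exists (lead_coef L * \prod_(z <- zs) - z).
  rewrite -scalerA; congr (_ *: _).
  elim: zs zn0 {Lzs} => [|z zs IH] /=; first by rewrite !big_nil scale1r.
  case/andP => z0 /IH {}IH; rewrite !big_cons IH -scalerAr.
  rewrite [(- z) * _]mulrC -scalerA; congr (_ *: _); rewrite scalerAl; congr (_ * _).
  rewrite scalerBr -mul_polyC mulr1 -mul_polyC mulrA -polyCM mulNr mulfV //.
  by rewrite !polyCN mulNr opprK mul1r addrC.
suff k1 : k = 1 by rewrite {1}Lk k1 scale1r.
have := L0; rewrite -horner_coef0 Lk hornerZ horner_prod big1 ?mulr1 // => w _.
by rewrite hornerD hornerN hornerM hornerX mulr0 subr0 hornerC.
Qed.

Lemma bernoulli_le (x : algC) k : 0 <= x -> 1 + k%:R * x <= (1 + x) ^+ k.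
Proof.
move=> x0; elim: k => [|k IH]; first by rewrite mul0r addr0 expr0.
rewrite exprS; apply: le_trans (_ : (1 + x) * (1 + k%:R * x) <= _); last first.
  by rewrite ler_wpM2l // addr_ge0.
rewrite -subr_ge0 -natr1.
have -> : (1 + x) * (1 + k%:R * x) - (1 + (k%:R + 1) * x) = k%:R * (x * x) by ring.
by rewrite mulr_ge0 ?ler0n ?mulr_ge0.
Qed.

Lemma exp_growth_le (a b R M : algC) k0 :
  0 < a -> 0 <= b -> 0 < R -> 
  (forall k, (k0 <= k)%N -> a * b ^+ k <= M * R ^+ k) -> b <= R.
Proof.
move=> a0 b0 R0 h.
have [//|Rb] := real_leP (ger0_real b0) (gtr0_real R0).
pose x := b / R - 1.
have x0 : 0 < x by rewrite subr_gt0 ltr_pdivlMr // mul1r.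
have bR : b = (1 + x) * R by rewrite /x addrC subrK divfK ?gt_eqF.
have h2 k : (k0 <= k)%N -> a * (1 + k%:R * x) <= M.
  move/h; rewrite {1}bR exprMn mulrA ler_pM2r ?exprn_gt0 //.
  apply: le_trans; rewrite ler_pM2l //; exact: bernoulli_le (ltW x0).
have M0 : 0 <= M.
  apply: le_trans (h2 k0 (leqnn _)).
  by rewrite mulr_ge0 ?ltW // ltr_wpDr // mulr_ge0 ?ler0n // ltW.
have ax : 0 < a * x by rewrite mulr_gt0.
have := archi_boundP (_ : 0 <= M / (a * x)); rewrite divr_ge0 ?(ltW ax) // => /(_ isT).
set n := Num.bound _; rewrite ltr_pdivrMr // => hn.
have := lt_le_trans (le_lt_trans (h2 (k0 + n)%N (leq_addr _ _)) hn) (_ : _ <= a * (1 + (k0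
  + n)%:R * x)).
rewrite ltxx; apply; rewrite -subr_ge0 natrD.
have -> : a * (1 + (k0%:R + n%:R) * x) - n%:R * (a * x) = a + k0%:R * (a * x) by ring.
by rewrite addr_ge0 ?mulr_ge0 ?ler0n ?ltW.
Qed.

(** Lagrange interpolation: with [E] vanishing at all the [t]-th powers of roots
    except [u = w^t], a fixed linear combination of consecutive power sums is a
    nonzero multiple of [u^k], so [u] cannot exceed the growth rate [R^t]. *)
Lemma power_sum_root_bound (ws : seq algC) (R C : algC) t k0 :
  0 < R -> (0 < t)%N ->
  (forall k, (k0 <= k)%N -> `|\sum_(w <- ws) w ^+ (t * k)| <= C * R ^+ (t * k)) ->
  forall w, w \in ws -> `|w| <= R.
Proof.
move=> R0 t0 h w wws.
pose us := [seq w ^+ t | w <- ws].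
pose u := w ^+ t.
have uus : u \in us by apply: map_f.
pose E : {poly algC} := \prod_(v <- rem u (undup us)) ('X - v%:P).
have Ev v : v \in us -> v != u -> E.[v] = 0.
  move=> vus vu; apply/eqP; rewrite -/(root E v) root_prod_XsubC.
  by rewrite mem_rem_uniq ?undup_uniq // inE vu mem_undup.
have Eu : E.[u] != 0.
  rewrite -/(root E u) root_prod_XsubC mem_rem_uniq ?undup_uniq //.
  by rewrite inE eqxx.
have key k : (count_mem u us)%:R * (u ^+ k * E.[u]) =
    \sum_(l < size E) E`_l * \sum_(w <- ws) w ^+ (t * (k + l)).
  transitivity (\sum_(v <- us) v ^+ k * E.[v]).
    rewrite (bigID (pred1 u)) /= [X in _ = _ + X]big_seq_cond.
    rewrite [X in _ = _ + X]big1 ?addr0 => [|v /andP [vus vu]]; last by rewrite Ev ?mulr0.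
    rewrite (eq_bigr (fun=> u ^+ k * E.[u])) => [|v /eqP -> //].
    by rewrite big_const_seq iter_addr_0 mulr_natl.
  rewrite big_map; under eq_bigr => v _ do rewrite horner_coef mulr_sumr.
  rewrite exchange_big /=; apply: eq_bigr => l _; rewrite mulr_sumr.
  by apply: eq_bigr => v _; rewrite mulnDr exprD !exprM; ring.
pose a := (count_mem u us)%:R * `|E.[u]|.
have a0 : 0 < a.
  by rewrite mulr_gt0 ?normr_gt0 // ltr0n -has_count has_pred1.
pose M := \sum_(l < size E) `|E`_l| * (C * R ^+ (t * l)).
suff : `|u| <= R ^+ t by rewrite /u normrX ler_pXn2r // nnegrE ?normr_ge0 ?ltW.
apply: (@exp_growth_le a `|u| (R ^+ t) M k0) => //; first by rewrite exprn_gt0.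
move=> k hk.
have -> : a * `|u| ^+ k = `|(count_mem u us)%:R * (u ^+ k * E.[u])|.
  by rewrite !normrM (normrX k u) normr_nat /a; ring.
rewrite key; apply: le_trans (ler_norm_sum _ _ _) _.
rewrite /M mulr_suml; apply: ler_sum => l _; rewrite normrM -mulrA.
apply: ler_wpM2l => //; apply: le_trans (h _ (leq_trans hk (leq_addr _ _))) _.
by rewrite le_eqVlt; apply/orP; left; apply/eqP; rewrite mulnDr exprD -exprM; ring.
Qed.

(** The numbers [S s] are minus the power sums of the reciprocal roots of
    [sum_n c_n X^n], of which there are at most [m - 1].  Any bound [C R^s] along
    the multiples of [t] bounds each root by [R], and the constant [C] no longer
    matters for [S 1]. *)
Lemma l_function_bound (c S : nat -> algC) (m : nat) (R C : algC) t k0 :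
  c 0 = 1 -> (forall n, (m <= n)%N -> c n = 0) -> 
  (forall n, n%:R * c n = \sum_(s < n) S s.+1 * c (n - s.+1)%N) ->
  0 < R -> (0 < t)%N ->
  (forall k, (k0 <= k)%N -> `|S (t * k)%N| <= C * R ^+ (t * k)) ->
  `|S 1%N| <= m.-1%:R * R.
Proof.
move=> c0 cm hS R0 t0 hb.
pose L := \poly_(i < m) c i.
have cL i : L`_i = c i.
  by rewrite coef_poly; case: ltnP => // hi; rewrite cm.
have [|ws Lws sws] := @closed_field_poly_normal1 _ L; first by rewrite cL.
have hT := newton_power_sums ws; rewrite /= -Lws in hT.
have SE s : S s.+1 = - \sum_(w <- ws) w ^+ s.+1.
  apply: (newton_unique (d := fun n => L`_n) c0 _ hS (T := fun s => - \sum_(w <- ws) w ^+ s)).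
    by move=> n; rewrite -cL.
  exact: hT.
have hw : forall w, w \in ws -> `|w| <= R.
  apply: (power_sum_root_bound (C := C) (k0 := k0.+1) R0 t0) => k hk.
  have := hb k (ltnW hk); have : (0 < t * k)%N by rewrite muln_gt0 t0 (leq_ltn_trans (leq0n
    k0) hk).
  by case: (t * k)%N => [//|s] _; rewrite SE normrN.
rewrite SE normrN; apply: le_trans (ler_norm_sum _ _ _) _.
apply: le_trans (_ : \sum_(w <- ws) R <= _).
  by rewrite big_seq [X in _ <= X]big_seq; apply: ler_sum => w ww; rewrite expr1 hw.
rewrite big_const_seq iter_addr_0 count_predT -[R *+ _]mulr_natl ler_wpM2r ?(ltW R0) // ler_nat.
have := leq_trans sws (size_poly _ _); case: (m) => //.
Qed.

(** * Frobenius and the finite subfields of a closure *)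

Section FrobeniusPower.
Variables (R : comNzRingType) (n : nat) (hn : [pchar R].-nat n).

(** The argument of type [[pchar R].-nat n] is what makes the ring morphism
    instances below available. *)
Definition frobenius_power (_ : [pchar R].-nat n) (x : R) := x ^+ n.
Local Notation fr := (frobenius_power hn).

Lemma frobenius_power_zmod : zmod_morphism fr.
Proof. by move=> x y; rewrite /frobenius_power exprBn_pnat. Qed.

Lemma frobenius_power_monoid : monoid_morphism fr.
Proof. by split=> [|x y]; rewrite /frobenius_power ?expr1n ?exprMn. Qed.

HB.instance Definition _ := GRing.isZmodMorphism.Build R R fr frobenius_power_zmod.
HB.instance Definition _ := GRing.isMonoidMorphism.Build R R fr frobenius_power_monoid.
End FrobeniusPower.

Lemma pnat_card_finField (F : finFieldType) : [pchar F].-nat #|F|.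
Proof.
have [p _ pF] := finPcharP F; rewrite (eq_pnat _ (pcharf_eq pF)).
by have /abelem_pgroup := fin_ring_pchar_abelem pF; rewrite /pgroup cardsT.
Qed.

Lemma pnat_rmorph (R S : nzRingType) (f : {rmorphism R -> S}) n :
  [pchar R].-nat n -> [pchar S].-nat n.
Proof. by apply: sub_in_pnat => p _; apply: rmorph_pchar. Qed.

Lemma dvdp_mup (K : closedFieldType) (p g : {poly K}) :
  p != 0 -> g != 0 -> (forall x, (mup x p <= mup x g)%N) -> p %| g.
Proof.
move=> p0 g0; have [rs Dp] := closed_field_poly_normal p.
have lp : lead_coef p != 0 by rewrite lead_coef_eq0.
rewrite Dp dvdpZl // => {Dp} h.
have {}h x : (count_mem x rs <= mup x g)%N.
  rewrite -mu_prod_XsubC; apply: leq_trans (h x).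
  by rewrite -mul_polyC mupM ?polyC_eq0 ?monic_neq0 ?monic_prod_XsubC // leq_addl.
elim: rs g g0 h => [|x rs IH] g g0 h; first by rewrite big_nil dvd1p.
have := h x; rewrite /= eqxx add1n => hx.
have /Pdiv.Field.dvdpP [g' gE] : 'X - x%:P %| g by rewrite XsubC_dvd // (leq_trans _ hx).
have g'0 : g' != 0 by apply: contraNneq g0 => z; rewrite gE z mul0r.
rewrite big_cons gE [g' * _]mulrC dvdp_mul2l ?polyXsubC_eq0 //.
apply: IH => // y; move: (h y); rewrite gE mupM ?polyXsubC_eq0 //=.
by rewrite (@mup_XsubCX K 1); case: eqP => _; rewrite ?addn1 ?addn0.
Qed.

Section Setup.
Variables (F : finFieldType) (K : closedFieldType) (iota : {rmorphism F -> K}).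
Local Notation q := #|F|.
Implicit Types (g h D P : {poly F}) (z : K).
Local Notation "p ^i" := (map_poly iota p) (at level 2, format "p ^i").

Let qK : [pchar K].-nat q := pnat_rmorph iota (pnat_card_finField F).

Lemma q_gt1 : (1 < q)%N. Proof. exact: finNzRing_gt1. Qed.

Lemma pnat_expq s : [pchar K].-nat (q ^ s)%N.
Proof. by rewrite pnatX qK. Qed.

(** [X^q - X] splits over [F]. *)
Lemma fixed_in_image z : z ^+ q = z -> exists a, z = iota a.
Proof.
move=> zq; have : root (map_poly iota ('X^q - 'X)) z.
  by rewrite rmorphB /= map_polyXn map_polyX /root !hornerE zq subrr.
rewrite finField_genPoly rmorph_prod /=.
under eq_bigr do rewrite rmorphB /= map_polyX map_polyC.
rewrite -(big_map iota predT (fun x => 'X - x%:P)) root_prod_XsubC.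
by case/mapP => a _ ->; exists a.
Qed.

Lemma image_fixed a : (iota a) ^+ q = iota a.
Proof. by rewrite -rmorphXn /= expf_card. Qed.

Definition unimage z : F := if [pick a | iota a == z] is Some a then a else 0.

Lemma unimageK a : unimage (iota a) = a.
Proof.
rewrite /unimage; case: pickP => [b /eqP /fmorph_inj //|/(_ a)].
by rewrite eqxx.
Qed.

Lemma unimageP z : z ^+ q = z -> iota (unimage z) = z.
Proof. by case/fixed_in_image => a ->; rewrite unimageK. Qed.

Definition frq := frobenius_power qK.

Lemma frq_map_poly_fixed g : map_poly frq g^i = g^i.
Proof.
apply/polyP => j; rewrite !coef_map /= /frobenius_power.
exact: image_fixed.
Qed.

(** Descent of a Frobenius-invariant polynomial to [F]. *)
Definition unmap_poly (p : {poly K}) : {poly F} := \poly_(j < size p) unimage p`_j.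

Lemma unmap_polyP (p : {poly K}) : map_poly frq p = p -> (unmap_poly p)^i = p.
Proof.
move=> pq; apply/polyP => j; rewrite coef_map coef_poly.
case: ltnP => hj; last by rewrite /= rmorph0 nth_default.
rewrite /= unimageP //; have := congr1 (fun r : {poly K} => r`_j) pq.
by rewrite coef_map.
Qed.

Definition roots_list (p : {poly K}) : seq K := sval (closed_field_poly_normal p).

Lemma roots_listE p : p = lead_coef p *: \prod_(z <- roots_list p) ('X - z%:P).
Proof. exact: svalP (closed_field_poly_normal p). Qed.

Lemma roots_list_monic p : p \is monic -> p = \prod_(z <- roots_list p) ('X - z%:P).
Proof. by move=> pm; rewrite {1}[p]roots_listE (monicP pm) scale1r. Qed.

Lemma mem_roots_list p z : p != 0 -> (z \in roots_list p) = root p z.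
Proof.
by move=> p0; rewrite {2}[p]roots_listE rootZ ?lead_coef_eq0 // root_prod_XsubC.
Qed.

Lemma size_roots_list p : p != 0 -> size (roots_list p) = (size p).-1.
Proof.
by move=> p0; rewrite {2}[p]roots_listE size_scale ?lead_coef_eq0 // size_prod_XsubC.
Qed.

Lemma count_roots_list p z : p != 0 -> count_mem z (roots_list p) = mup z p.
Proof.
move=> p0; rewrite {2}[p]roots_listE -mul_polyC mupM ?polyC_eq0 ?lead_coef_eq0 //.
  by rewrite mup_const ?lead_coef_eq0 // mu_prod_XsubC.
by rewrite monic_neq0 // monic_prod_XsubC.
Qed.

Lemma roots_list_prod (s : seq K) : perm_eq (roots_list (\prod_(z <- s) ('X - z%:P))) s.
Proof.
by apply: prod_XsubC_eq; rewrite -roots_list_monic // monic_prod_XsubC.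
Qed.

Lemma roots_listM p1 p2 : p1 != 0 -> p2 != 0 -> perm_eq (roots_list (p1 * p2)) (roots_list
  p1 ++ roots_list p2).
Proof.
move=> h1 h2; apply/allP => z _ /=.
by rewrite count_cat !count_roots_list ?mulf_neq0 // mupM.
Qed.

Lemma frq_prod_XsubC (s : seq K) :
  map_poly frq (\prod_(z <- s) ('X - z%:P)) = \prod_(z <- [seq z ^+ q | z <- s]) ('X - z%:P).
Proof.
rewrite rmorph_prod /= big_map; apply: eq_bigr => z _.
by rewrite rmorphB /= map_polyX map_polyC.
Qed.

Lemma roots_list_frq g : g != 0 -> perm_eq [seq z ^+ q | z <- roots_list g^i] (roots_list g^i).
Proof.
move=> g0; apply: prod_XsubC_eq; rewrite -frq_prod_XsubC.
have gi0 : g^i != 0 by rewrite map_poly_eq0.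
have lg : lead_coef g^i != 0 by rewrite lead_coef_eq0.
apply: (scalerI lg); rewrite -roots_listE.
rewrite -[RHS]frq_map_poly_fixed {3}[g^i]roots_listE map_polyZ /=; congr (_ *: _).
by rewrite lead_coef_map -[LHS]image_fixed.
Qed.

Lemma frq_inj : injective (fun z : K => z ^+ q).
Proof. exact: (fmorph_inj frq). Qed.

Lemma frqX_inj s : injective (fun z : K => z ^+ (q ^ s)).
Proof. exact: (fmorph_inj (frobenius_power (pnat_expq s))). Qed.

Lemma mup_frq g z : g != 0 -> mup (z ^+ q) g^i = mup z g^i.
Proof.
move=> g0; have gi0 : g^i != 0 by rewrite map_poly_eq0.
rewrite -!count_roots_list // -(seq.permP (roots_list_frq g0)) count_map.
by apply: eq_count => x /=; rewrite (inj_eq frq_inj).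
Qed.

Lemma mup_frqX g z s : g != 0 -> mup (z ^+ (q ^ s)) g^i = mup z g^i.
Proof.
by move=> g0; elim: s => [|s IH]; rewrite ?expn0 ?expr1 ?expnSr ?exprM ?mup_frq.
Qed.

Definition subfield_points s : seq K := roots_list ('X^(q ^ s) - 'X).

Lemma expq_gt1 s : (0 < s)%N -> (1 < q ^ s)%N.
Proof. by move=> s0; have := ltn_exp2l 0 s q_gt1; rewrite expn0 s0. Qed.

Lemma pt_poly_size s : (0 < s)%N -> size ('X^(q ^ s) - 'X : {poly K}) = (q ^ s).+1.
Proof.
move=> s0; rewrite size_polyDl size_polyXn // size_polyN size_polyX ltnS.
exact: expq_gt1.
Qed.

Lemma pt_poly_neq0 s : (0 < s)%N -> ('X^(q ^ s) - 'X : {poly K}) != 0.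
Proof. by move=> s0; rewrite -size_poly_gt0 pt_poly_size. Qed.

Lemma mem_points s z : (0 < s)%N -> (z \in subfield_points s) = (z ^+ (q ^ s) == z).
Proof.
by move=> s0; rewrite mem_roots_list ?pt_poly_neq0 // /root !hornerE subr_eq0.
Qed.

Lemma size_points s : (0 < s)%N -> size (subfield_points s) = (q ^ s)%N.
Proof. by move=> s0; rewrite size_roots_list ?pt_poly_neq0 // pt_poly_size. Qed.

Lemma uniq_points s : (0 < s)%N -> uniq (subfield_points s).
Proof.
move=> s0; rewrite -separable_prod_XsubC -roots_list_monic; last first.
  by rewrite monicE lead_coefDl ?lead_coefXn // size_polyXn size_polyN size_polyX ltnS expq_gt1.
have q0 : q%:R = 0 :> K.
  rewrite -(rmorph_nat iota); suff -> : q%:R = 0 :> F by rewrite rmorph0.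
  by rewrite -FinRing.zmodXgE -cardsT expg_cardG ?inE.
rewrite separable_poly.unlock derivB derivX derivXn -mulr_natl.
case: s s0 => // s _; rewrite expnS natrM -polyC_natr q0 mul0r mul0r sub0r.
by rewrite -[X in coprimep _ X]scaleN1r coprimepZr ?oppr_eq0 ?oner_eq0 // coprimep1.
Qed.
End Setup.

(** * Newton's identities for the L-function of a character *)

Section MonicPolynomials.
Variable F : fieldType.
Implicit Types g D : {poly F}.

Definition monic_of n (w : 'rV[F]_n) : {poly F} := 'X^n + rVpoly w.

Lemma size_monic_of n (w : 'rV[F]_n) : size (monic_of w) = n.+1.
Proof. by rewrite size_polyDl size_polyXn // ltnS size_poly. Qed.

Lemma monic_of_monic n (w : 'rV[F]_n) : monic_of w \is monic.
Proof. by rewrite monicE lead_coefDl ?lead_coefXn // size_polyXn ltnS size_poly. Qed.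

Lemma monic_of_neq0 n (w : 'rV[F]_n) : monic_of w != 0.
Proof. exact: monic_neq0 (monic_of_monic w). Qed.

Lemma monic_ofK n (w : 'rV[F]_n) : poly_rV (monic_of w - 'X^n) = w.
Proof. by rewrite /monic_of addrC addrA addNr add0r rVpolyK. Qed.

Lemma monic_of_poly n g : g \is monic -> size g = n.+1 -> monic_of (poly_rV (g - 'X^n) :
  'rV_n) = g.
Proof.
move=> gm sg; rewrite /monic_of poly_rV_K; first by rewrite addrC subrK.
apply/leq_sizeP => j; rewrite leq_eqVlt => /orP [/eqP <-|hj].
  have := monicP gm; rewrite lead_coefE sg /= coefB coefXn eqxx => ->.
  by rewrite subrr.
by rewrite coefB coefXn gtn_eqF // subr0 nth_default // sg.
Qed.
End MonicPolynomials.

(** [monic_of] parametrizes the monic polynomials of degree [n] by [F^n]; those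
    divisible by [D] are the [D g] with [g] monic of degree [n - s]. *)
Lemma sum_monic_multiples (F : finFieldType) (C : nmodType) (D : {poly F}) s n (G : {poly
  F} -> C) :
  D \is monic -> size D = s.+1 -> (s <= n)%N ->
  \sum_(w : 'rV[F]_(n - s)) G (D * monic_of w) =
  \sum_(w : 'rV[F]_n | D %| monic_of w) G (monic_of w).
Proof.
move=> Dm sD sn; have D0 := monic_neq0 Dm.
pose f (w : 'rV[F]_(n - s)) : 'rV[F]_n := poly_rV (D * monic_of w - 'X^n).
have fE w : monic_of (f w) = D * monic_of w.
  apply: monic_of_poly; first by rewrite monicMl ?monic_of_monic.
  by rewrite size_Mmonic ?monic_of_monic // size_monic_of sD addSn /= addnS subnKC.
pose f' (w : 'rV[F]_n) : 'rV[F]_(n - s) := poly_rV (monic_of w %/ D - 'X^(n - s)).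
rewrite [RHS](reindex_onto f f') /=.
  apply: eq_big => [w|w _]; last by rewrite fE.
  rewrite fE dvdp_mulr // /f' fE mulrC mulpK // monic_ofK eqxx //.
move=> w Dw; have [g gE] := Pdiv.Field.dvdpP _ _ Dw.
have gm : g \is monic by rewrite -(monicMr _ Dm) -gE monic_of_monic.
rewrite /f; have -> : D * monic_of (f' w) = monic_of w.
  rewrite /f' monic_of_poly ?gE ?mulpK // 1?mulrC //.
  have := size_monic_of w; rewrite gE size_Mmonic ?monic_neq0 // sD addnS /=.
  by move: (size g) => k; lia.
exact: monic_ofK.
Qed.

Section LFunction.
Variables (F : finFieldType) (K : closedFieldType) (iota : {rmorphism F -> K}).
Variable chi : F -> algC.
Hypothesis chi1 : chi 1 = 1.
Hypothesis chiM : {morph chi : x y / x * y}.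
Variable P : {poly F}.

Local Notation q := #|F|.
Implicit Types (g h D : {poly F}) (z : K).
Local Notation "p ^i" := (map_poly iota p) (at level 2, format "p ^i").
Local Notation points := (subfield_points F K).

Definition char_ext z := chi (unimage iota z).

Lemma char_extM x y : x ^+ q = x -> y ^+ q = y -> char_ext (x * y) = char_ext x * char_ext y.
Proof.
move=> /(fixed_in_image iota) [a ->] /(fixed_in_image iota) [b ->].
by rewrite /char_ext -rmorphM !unimageK chiM.
Qed.

(** The resultant of [g] and [P] for monic [g]; written over the roots of [g] it is
    visibly multiplicative in [g]. *)
Definition root_prod g : K := \prod_(z <- roots_list g^i) P^i.[z].

Lemma exprq_horner g z : g^i.[z] ^+ q = g^i.[z ^+ q].
Proof.
have := horner_map (frq iota) g^i z.
by rewrite frq_map_poly_fixed /= /frobenius_power => <-.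
Qed.

Lemma exprqX_horner g z s : g^i.[z] ^+ (q ^ s) = g^i.[z ^+ (q ^ s)].
Proof.
elim: s => [|s IH]; first by rewrite expn0 !expr1.
by rewrite expnSr !exprM IH exprq_horner.
Qed.

Lemma root_prod_fixed g : g != 0 -> root_prod g ^+ q = root_prod g.
Proof.
move=> g0; rewrite /root_prod -prodrXl.
under eq_bigr do rewrite exprq_horner.
rewrite -(big_map (fun z => z ^+ q) predT (fun z => P^i.[z])) /=.
exact: perm_big (roots_list_frq iota g0).
Qed.

Lemma root_prodM g h : g != 0 -> h != 0 -> root_prod (g * h) = root_prod g * root_prod h.
Proof.
move=> g0 h0; rewrite /root_prod rmorphM -big_cat /=.
by apply: perm_big; apply: roots_listM; rewrite map_poly_eq0.
Qed.

Definition poly_char g := char_ext (root_prod g).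

Lemma poly_charM g h : g != 0 -> h != 0 -> poly_char (g * h) = poly_char g * poly_char h.
Proof.
by move=> g0 h0; rewrite /poly_char root_prodM // char_extM ?root_prod_fixed.
Qed.

Lemma poly_char1 : poly_char 1 = 1.
Proof.
rewrite /poly_char /root_prod rmorph1 big1_seq; first by rewrite /char_ext -(rmorph1 iota)
  unimageK.
by move=> z /andP [_]; rewrite mem_roots_list ?oner_neq0 // (negPf (root1 z)).
Qed.

(** For [z] in the field with [q^s] elements, this is the characteristic polynomial
    of [z] over [F]. *)
Definition conj_prod s z : {poly K} := \prod_(i < s) ('X - (z ^+ (q ^ i))%:P).

Lemma conj_prodE s z :
  conj_prod s z = \prod_(x <- [seq z ^+ (q ^ i) | i <- index_iota 0 s]) ('X - x%:P).
Proof. by rewrite big_map big_mkord. Qed.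

Lemma conj_prod_fixed s z : (0 < s)%N -> z \in points s ->
  map_poly (frq iota) (conj_prod s z) = conj_prod s z.
Proof.
move=> s0; rewrite mem_points // => /eqP zs.
rewrite conj_prodE frq_prod_XsubC !big_map !big_mkord.
case: s s0 zs => // s _ zs; rewrite big_ord_recr big_ord_recl /= mulrC.
rewrite -exprM -expnSr zs expn0 expr1; congr (_ * _).
by apply: eq_bigr => i _; rewrite /bump /= add1n -exprM -expnSr.
Qed.

Definition conj_poly s z : {poly F} := unmap_poly iota (conj_prod s z).

Lemma conj_polyE s z : (0 < s)%N -> z \in points s -> (conj_poly s z)^i = conj_prod s z.
Proof. by move=> s0 zs; rewrite unmap_polyP // conj_prod_fixed. Qed.

Lemma conj_poly_monic s z : (0 < s)%N -> z \in points s -> conj_poly s z \is monic.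
Proof.
move=> s0 zs; rewrite -(map_monic iota) conj_polyE // conj_prodE.
exact: monic_prod_XsubC.
Qed.

Lemma size_conj_poly s z : (0 < s)%N -> z \in points s -> size (conj_poly s z) = s.+1.
Proof.
move=> s0 zs; rewrite -(size_map_poly iota) conj_polyE // conj_prodE.
by rewrite size_prod_XsubC size_map size_iota subn0.
Qed.

Lemma root_prod_conj s z : (0 < s)%N -> z \in points s ->
  root_prod (conj_poly s z) = \prod_(i < s) P^i.[z ^+ (q ^ i)].
Proof.
move=> s0 zs; rewrite /root_prod conj_polyE // conj_prodE.
by rewrite (perm_big _ (roots_list_prod _)) big_map big_mkord.
Qed.

(** The coefficient of [T^n] in the L-function of [chi] along [P]. *)
Definition lcoef n : algC := \sum_(w : 'rV[F]_n) poly_char (monic_of w).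
(** The sum of [chi(Norm(P(z)))] over the field with [q^s] elements, the norm of
    [P(z)] being the resultant of [P] with the characteristic polynomial of [z]. *)
Definition norm_sum s : algC := \sum_(z <- points s) poly_char (conj_poly s z).

Lemma sum_nat_bool_count (T : Type) (a : pred T) (r : seq T) :
  (\sum_(x <- r) (a x : nat) = count a r)%N.
Proof. by rewrite -sum1_count [RHS]big_mkcond. Qed.

Lemma sum_dvdn e N : (0 < e)%N -> (\sum_(s < N) (e %| s.+1) = N %/ e)%N.
Proof.
move=> e0; elim: N => [|N IH]; first by rewrite big_ord0 div0n.
by rewrite big_ord_recr /= IH divnS // addnC.
Qed.

(** The roots of [g] are permuted by Frobenius, so the orbit of [z] is finite; [e]
    is its length, the degree of [z] over [F]. *)
Lemma frob_order g z : g != 0 -> root g^i z ->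
  exists e, [/\ (0 < e)%N, z ^+ (q ^ e) = z,
     (forall s, (z ^+ (q ^ s) == z) = (e %| s)%N) &
     uniq [seq z ^+ (q ^ i) | i <- index_iota 0 e]].
Proof.
move=> g0 gz.
have gi0 : g^i != 0 by rewrite map_poly_eq0.
have rz i : root g^i (z ^+ (q ^ i)) by rewrite /root -exprqX_horner (eqP gz) expr0n gtn_eqF
  ?expn_gt0 ?(ltnW (q_gt1 F)).
have mv i j : (i <= j)%N -> z ^+ (q ^ i) = z ^+ (q ^ j) -> z ^+ (q ^ (j - i)) = z.
  move=> ij; rewrite -{1}(subnK ij) expnD exprM => h.
  by apply: (frqX_inj iota (s := i)); rewrite /= -h.
have ex : exists e, (0 < e)%N && (z ^+ (q ^ e) == z).
  pose m := (size (roots_list g^i)).+1.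
  have : ~~ uniq [seq z ^+ (q ^ i) | i <- index_iota 0 m].
    apply/negP => hu; have : (size [seq z ^+ (q ^ i) | i <- index_iota 0 m] <= size
      (roots_list g^i))%N.
      by apply: uniq_leq_size hu _ => x /mapP [i _ ->]; rewrite mem_roots_list.
    by rewrite size_map size_iota subn0 ltnn.
  case/(uniqPn 0) => i [j [ij]]; rewrite size_map size_iota subn0 => jm.
  have im := ltn_trans ij jm.
  rewrite !(nth_map 0%N) ?size_iota ?subn0 // !nth_iota ?subn0 //.
  rewrite !add0n => /(mv _ _ (ltnW ij)) h; exists (j - i)%N.
  by rewrite subn_gt0 ij h eqxx.
case: (ex_minnP ex) => e /andP [e0 /eqP ze] emin; exists e; split=> //.
  move=> s; have zke k : z ^+ (q ^ (k * e)) = z.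
    by elim: k => [|k IH]; rewrite ?mul0n ?expn0 ?expr1 // mulSn expnD exprM ze.
  rewrite {1}(divn_eq s e) expnD exprM zke /dvdn.
  have [->|r0] := eqVneq (s %% e)%N 0%N; first by rewrite expn0 expr1 eqxx.
  apply/negP => h; have := emin (s %% e)%N; rewrite lt0n r0 h => /(_ isT).
  by rewrite leqNgt ltn_pmod.
apply/negP => /negP /(uniqPn 0) [i [j [ij]]]; rewrite size_map size_iota subn0 => je.
have ie := ltn_trans ij je.
rewrite !(nth_map 0%N) ?size_iota ?subn0 // !nth_iota ?subn0 //.
rewrite !add0n => /(mv _ _ (ltnW ij)) h; have := emin (j - i)%N.
rewrite subn_gt0 ij h eqxx => /(_ isT); rewrite leqNgt.
by rewrite (leq_ltn_trans (leq_subr _ _) je).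
Qed.

(** [conj_prod (s * e) z] is the [s]-th power of the minimal polynomial of [z], and
    all the conjugates of [z] have the same multiplicity in [g]. *)
Lemma conj_prod_dvd g z s e : g != 0 -> (0 < e)%N ->
  z ^+ (q ^ e) = z -> uniq [seq z ^+ (q ^ i) | i <- index_iota 0 e] ->
  (conj_prod (s * e) z %| g^i) = (s <= mup z g^i)%N.
Proof.
move=> g0 e0 ze ue.
have gi0 : g^i != 0 by rewrite map_poly_eq0.
have -> : conj_prod (s * e) z = conj_prod e z ^+ s.
  elim: s => [|s IH]; first by rewrite /conj_prod mul0n big_ord0 expr0.
  rewrite exprS -IH /conj_prod mulSn big_split_ord /=; congr (_ * _).
  by apply: eq_bigr => i _; rewrite expnD exprM ze.
have c0 : conj_prod e z != 0 by rewrite conj_prodE monic_neq0 // monic_prod_XsubC.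
apply/idP/idP => [h|h].
  rewrite mup_geq //; apply: dvdp_trans h; apply: dvdp_exp2r.
  case: (e) e0 => // e' _; rewrite /conj_prod big_ord_recl expn0 expr1.
  exact: dvdp_mulr.
apply: dvdp_mup => [||x]; [by rewrite expf_neq0 | exact: gi0 |].
rewrite (mup_exp _ _ c0) conj_prodE mu_prod_XsubC (count_uniq_mem _ ue).
case: mapP => [[i _ ->]|_]; last by rewrite muln0 leq0n.
by rewrite muln1 mup_frqX.
Qed.

Lemma count_conj_prod_dvd g z n : g != 0 -> (size g <= n.+1)%N -> root g^i z ->
  (\sum_(s < n) ((z \in points s.+1) && (conj_prod s.+1 z %| g^i)%R) = mup z g^i)%N.
Proof.
move=> g0 sg gz; have [e [e0 ze zs ue]] := frob_order g0 gz.
have gi0 : g^i != 0 by rewrite map_poly_eq0.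
set M := mup z g^i.
have Mn : (M * e <= n)%N.
  have := leqnn M; rewrite {2}/M -(@conj_prod_dvd g z M e) // => /(dvdp_leq gi0).
  rewrite conj_prodE size_prod_XsubC size_map size_iota subn0 size_map_poly.
  by move=> h; rewrite -ltnS (leq_trans h).
transitivity (\sum_(s < M * e) (e %| s.+1))%N; last by rewrite sum_dvdn // mulnK.
rewrite (big_ord_widen_cond n xpredT (fun s => (e %| s.+1) : nat)) //= [RHS]big_mkcond /=.
apply: eq_bigr => s _; rewrite mem_points // zs.
case: dvdnP => [[k ks]|_] /=; last by rewrite if_same.
by rewrite ks conj_prod_dvd // -ks ks leq_mul2r eqn0Ngt e0 /=; case: leqP.
Qed.

(** Each root [z] of [g], of degree [e] and multiplicity [M], contributes exactly
    the [M] values [s = e, 2e, ..., Me]; the multiplicities add up to the degree. *)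
Lemma sum_points_conj_dvd g n : g \is monic -> size g = n.+1 ->
  (\sum_(s < n) \sum_(z <- points s.+1) (conj_poly s.+1 z %| g)%R = n)%N.
Proof.
move=> gm sg; have g0 := monic_neq0 gm.
have gi0 : g^i != 0 by rewrite map_poly_eq0.
pose U := undup (roots_list g^i).
have -> : (\sum_(s < n) \sum_(z <- points s.+1) (conj_poly s.+1 z %| g)%R =
  \sum_(s < n) \sum_(z <- U) ((z \in points s.+1) && (conj_prod s.+1 z %| g^i)%R))%N.
  apply: eq_bigr => s _.
  have hz z : z \in points s.+1 -> (conj_poly s.+1 z %| g) = (conj_prod s.+1 z %| g^i).
    by move=> hz; rewrite -(dvdp_map iota) conj_polyE.
  rewrite !sum_nat_bool_count -!size_filter; apply: perm_size.
  apply: uniq_perm => [||z]; rewrite ?filter_uniq ?uniq_points ?undup_uniq //.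
  rewrite !mem_filter mem_undup [z \in roots_list g^i]mem_roots_list //.
  case hzp: (z \in points s.+1); last by rewrite andbF.
  rewrite andTb andbT hz //.
  apply/idP/andP => [h|[]//]; split=> //.
  move: h; rewrite /conj_prod big_ord_recl expn0 expr1 => h.
  by rewrite -dvdp_XsubCl; apply: dvdp_trans h; exact: dvdp_mulr.
rewrite exchange_big /= big_seq.
rewrite (eq_bigr (fun z => count_mem z (roots_list g^i))) => [|z]; last first.
  rewrite mem_undup mem_roots_list // => gz.
  by rewrite count_conj_prod_dvd ?sg // count_roots_list.
rewrite -big_seq.
have := big_undup_iterop_count addn (roots_list g^i) xpredT (fun=> 1%N).
rewrite sum1_size size_roots_list // size_map_poly sg /= => <-.
by apply: eq_bigr => z _; rewrite Monoid.iteropE iter_addn_0 mul1n.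
Qed.

(** Both sides sum the character over the monic [g] of degree [n] together with a
    factorization [g = D h] in which [D] is the characteristic polynomial of a
    point.  Each [g] has [n] of them by [sum_points_conj_dvd], and the character is
    multiplicative. *)
Lemma newton_lcoef n :
  n%:R * lcoef n = \sum_(s < n) norm_sum s.+1 * lcoef (n - s.+1)%N.
Proof.
transitivity (\sum_(s < n) \sum_(z <- points s.+1)
    \sum_(w : 'rV[F]_n | conj_poly s.+1 z %| monic_of w) poly_char (monic_of w)); last first.
  apply: eq_bigr => s _; rewrite mulr_suml big_seq [RHS]big_seq; apply: eq_bigr => z zs.
  rewrite -(sum_monic_multiples poly_char (conj_poly_monic _ zs) (size_conj_poly _ zs)) //.
  rewrite mulr_sumr; apply: eq_bigr => w _.
  by rewrite poly_charM ?monic_of_neq0 // monic_neq0 // conj_poly_monic.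
under [RHS]eq_bigr => s _.
  under eq_bigr => z _ do rewrite big_mkcond /=.
  rewrite exchange_big /=; over.
rewrite exchange_big /= mulr_sumr; apply: eq_bigr => w _.
have -> : n%:R * poly_char (monic_of w) = (\sum_(s < n) \sum_(z <- points s.+1)
    (conj_poly s.+1 z %| monic_of w)%R)%N%:R * poly_char (monic_of w) :> algC.
  by rewrite (sum_points_conj_dvd (monic_of_monic w) (size_monic_of w)).
rewrite natr_sum mulr_suml; apply: eq_bigr => s _.
rewrite natr_sum mulr_suml; apply: eq_bigr => z _.
by case: (_ %| _); rewrite ?mul1r ?mul0r.
Qed.
End LFunction.

(** * The L-function is a polynomial *)

Section Vanishing.
Variables (F : finFieldType) (K : closedFieldType) (iota : {rmorphism F -> K}).
Variable chi : F -> algC.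
Hypothesis chi0 : chi 0 = 0.
Hypothesis chiM : {morph chi : x y / x * y}.
Variables P H : {poly F}.
Hypothesis P0 : P != 0.
Hypothesis H0 : H != 0.
Local Notation "p ^i" := (map_poly iota p) (at level 2, format "p ^i").
Hypothesis PH : forall z, root P^i z = root H^i z.

Local Notation q := #|F|.
Implicit Types (g h D : {poly F}) (z : K).
Local Notation chiK := (char_ext iota chi).
Local Notation lam := (poly_char iota chi P).

(** The resultant of [P] and [g] taken over the roots of [P]; up to a factor
    depending only on the degree of [g] it is [root_prod g], and it only depends
    on [g] modulo the roots of [P]. *)
Definition value_prod g : K := \prod_(b <- roots_list P^i) g^i.[b].
Definition value_char g := chiK (value_prod g).

Lemma value_prod_fixed g : value_prod g ^+ q = value_prod g.
Proof.
rewrite /value_prod -prodrXl.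
under eq_bigr do rewrite exprq_horner.
rewrite -(big_map (fun z => z ^+ q) predT (fun z => g^i.[z])) /=.
exact: perm_big (roots_list_frq iota P0).
Qed.

Lemma char_ext_iota a : chiK (iota a) = chi a.
Proof. by rewrite /char_ext unimageK. Qed.

Lemma value_charM g h : value_char (g * h) = value_char g * value_char h.
Proof.
rewrite /value_char -char_extM ?value_prod_fixed //; congr chiK.
by rewrite -big_split /=; apply: eq_bigr => b _; rewrite rmorphM hornerM.
Qed.

Lemma value_char_modp g h : g %% H = h %% H -> value_char g = value_char h.
Proof.
move=> gh; congr chiK; rewrite /value_prod big_seq [RHS]big_seq; apply: eq_bigr => b.
have Pi0 : P^i != 0 by rewrite map_poly_eq0.
rewrite (mem_roots_list b Pi0) PH => /eqP Hb.
have E k : k^i.[b] = (k %% H)^i.[b].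
  by rewrite {1}(divp_eq k H) rmorphD rmorphM /= hornerD hornerM Hb mulr0 add0r.
by rewrite E gh -E.
Qed.

(** Reciprocity: both sides are products of the differences of the roots of [g] and
    of [P]. *)
Lemma root_prod_value_prod g : g \is monic ->
  root_prod iota P g = iota (lead_coef P ^+ (size g).-1 * (-1) ^+ ((size g).-1 * (size
    P).-1)) * value_prod g.
Proof.
move=> gm; rewrite /root_prod /value_prod.
have gi0 : g^i != 0 by rewrite map_poly_eq0 monic_neq0.
have Pi0 : P^i != 0 by rewrite map_poly_eq0.
have gim : g^i \is monic by rewrite map_monic.
under eq_bigr => z _ do rewrite {1}[P^i]roots_listE hornerZ horner_prod.
rewrite big_split /= [X in X * _]big_const_seq count_predT.
under [in RHS]eq_bigr => b _ do rewrite (roots_list_monic gim) horner_prod.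
rewrite [in RHS]exchange_big /= rmorphM !rmorphXn rmorphN1 -mulrA; congr (_ * _).
  by rewrite lead_coef_map size_roots_list // size_map_poly iter_mulr_1.
rewrite exprM.
have -> : (-1 : K) ^+ (size g).-1 ^+ (size P).-1 = \prod_(z <- roots_list g^i) \prod_(b <-
  roots_list P^i) -1.
  rewrite !big_const_seq !count_predT !size_roots_list // !size_map_poly !iter_mulr_1.
  by rewrite exprAC.
rewrite -big_split /=; apply: eq_bigr => z _.
rewrite -big_split /=; apply: eq_bigr => b _.
by rewrite !hornerE mulN1r opprB.
Qed.

Lemma poly_char_value g : g \is monic ->
  lam g = chi (lead_coef P ^+ (size g).-1 * (-1) ^+ ((size g).-1 * (size P).-1)) * value_char g.
Proof.
move=> gm; rewrite /poly_char root_prod_value_prod // char_extM ?value_prod_fixed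
  ?image_fixed //.
by rewrite char_ext_iota.
Qed.

Lemma value_char_coprimep u : value_char u != 0 -> coprimep u H.
Proof.
move=> mu0; rewrite -(coprimep_map iota); apply/negPn/negP.
rewrite coprimep_def => /closed_rootP [b].
rewrite root_gcd -PH => /andP [ub Pb].
have Pi0 : P^i != 0 by rewrite map_poly_eq0.
move: mu0; rewrite /value_char /value_prod (big_rem b) /=; last by rewrite mem_roots_list.
by rewrite (eqP ub) mul0r -(rmorph0 iota) char_ext_iota chi0 eqxx.
Qed.

(** The map [g |-> g + ((u - 1) g mod H)] permutes the monic polynomials of degree
    [n >= deg H] and sends [g] to something congruent to [u g] modulo [H], so the
    sum is multiplied by [value_char u], which is not 1. *)
Lemma lcoef_eq0 u n : value_char u != 0 -> value_char u != 1 -> ((size H).-1 <= n)%N ->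
  lcoef iota chi P n = 0.
Proof.
move=> u0 u1 hn.
pose t (w : 'rV[F]_n) : {poly F} := ((u - 1) * monic_of w) %% H.
have st w : (size (t w) <= n)%N.
  by rewrite (leq_trans _ hn) // -ltnS prednK ?size_poly_gt0 // ltn_modpN0.
pose f (w : 'rV[F]_n) : 'rV[F]_n := w + poly_rV (t w).
have fE w : monic_of (f w) = monic_of w + t w.
  by rewrite /f /monic_of linearD /= poly_rV_K // addrA.
have muf w : value_char (monic_of (f w)) = value_char u * value_char (monic_of w).
  rewrite -value_charM; apply: value_char_modp; rewrite fE /t modpD modp_id -modpD.
  by congr (_ %% _); ring.
have finj : injective f.
  move=> w1 w2 /(congr1 (@monic_of F n)); rewrite !fE => h.
  have h1 : (monic_of w1 - monic_of w2) = - (((u - 1) * (monic_of w1 - monic_of w2)) %% H).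
    rewrite mulrBr modpD modpN -!/(t _) opprB.
    by apply/eqP; rewrite subr_eq addrAC eq_sym subr_eq h addrC.
  set dl := _ - _ in h1.
  have : H %| u * dl.
    apply/modp_eq0P; have -> : u * dl = dl + (u - 1) * dl by ring.
    by rewrite modpD {1}h1 modpN modp_id addNr.
  rewrite Gauss_dvdpr; last by rewrite coprimep_sym value_char_coprimep.
  move=> Hd; have dl0 : dl = 0.
    by rewrite h1 (modp_eq0P _ _ _) ?oppr0 // dvdp_mull.
  have : monic_of w1 = monic_of w2 by apply/subr0_eq.
  by move/(congr1 (fun g => poly_rV (g - 'X^n) : 'rV_n)); rewrite !monic_ofK.
have : value_char u * \sum_(w : 'rV[F]_n) value_char (monic_of w) = \sum_(w : 'rV[F]_n)
  value_char (monic_of w).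
  rewrite mulr_sumr [RHS](reindex_inj finj) /=.
  by apply: eq_bigr => w _; rewrite muf.
move/eqP; rewrite -subr_eq0 -[X in _ - X]mul1r -mulrBl mulf_eq0 subr_eq0 (negPf u1) /=.
move=> /eqP h; rewrite /lcoef.
under eq_bigr => w _ do rewrite poly_char_value ?monic_of_monic // size_monic_of.
by rewrite -mulr_sumr h mulr0.
Qed.

End Vanishing.

(** * The Weil bound for multiplicative characters *)

Lemma finField_prim_root (F : finFieldType) : exists g : F, (#|F|.-1).-primitive_root g.
Proof.
have q1 := finNzRing_gt1 F.
have /hasP [g _ gp] : has (#|F|.-1).-primitive_root (enum (predC1 (0 : F))).
  apply: has_prim_root.
  - by rewrite -ltnS prednK // ltnW.
  - apply/allP => x; rewrite mem_enum !inE => x0; rewrite unity_rootE; apply/eqP.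
    apply: (mulfI x0); rewrite -exprS prednK ?(ltnW q1) // mulr1; exact: expf_card.
  - exact: enum_uniq.
  - by rewrite -cardE cardC1.
by exists g.
Qed.

Section Character.
Variables (F : finFieldType) (gam : F).
Hypothesis gamP : (#|F|.-1).-primitive_root gam.
Local Notation q := #|F|.

Definition dlog (a : F) : nat := if [pick i : 'I_q | gam ^+ i == a] is Some i then i else 0.

Lemma dlogP a : a != 0 -> gam ^+ dlog a = a.
Proof.
move=> a0; rewrite /dlog; case: pickP => [i /eqP //|h].
have a1 : a ^+ q.-1 = 1.
  apply: (mulfI a0); rewrite -exprS prednK ?expf_card ?mulr1 //.
  by apply: ltnW; exact: finNzRing_gt1.
have [i hi] := prim_rootP gamP a1.
have iq : (i < q)%N by apply: leq_trans (ltn_ord i) (leq_pred _).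
by have := h (Ordinal iq); rewrite /= hi eqxx.
Qed.

Lemma gam_neq0 : gam != 0.
Proof.
apply: contraTneq isT => g0; have := prim_expr_order gamP; rewrite g0 expr0n.
have := prim_order_gt0 gamP; case: (q.-1) => // n _ /esym/eqP.
by rewrite oner_eq0.
Qed.

Lemma dlog_eqmod a k : a = gam ^+ k -> dlog a = k %[mod q.-1].
Proof.
move=> ak; apply/eqP; rewrite -(eq_prim_root_expr gamP) dlogP ?ak //.
by rewrite expf_neq0 // gam_neq0.
Qed.

Definition mchar (w : algC) (a : F) : algC := if a == 0 then 0 else w ^+ dlog a.

Section Order.
Variables (w : algC) (d : nat).
Hypothesis dq : (d %| q.-1)%N.
Hypothesis wd : w ^+ d = 1.

Let wq : w ^+ q.-1 = 1.
Proof. by case/dvdnP: dq => k ->; rewrite mulnC exprM wd expr1n. Qed.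

Lemma mchar_gam k : mchar w (gam ^+ k) = w ^+ k.
Proof.
rewrite /mchar expf_eq0 (negPf gam_neq0) andbF.
by rewrite -(expr_mod _ wq) (@dlog_eqmod _ k) // expr_mod.
Qed.

Lemma mchar0 : mchar w 0 = 0. Proof. by rewrite /mchar eqxx. Qed.

Lemma mchar1 : mchar w 1 = 1. Proof. by rewrite -(expr0 gam) mchar_gam. Qed.

Lemma mcharM : {morph mchar w : x y / x * y}.
Proof.
move=> x y; have [->|x0] := eqVneq x 0; first by rewrite mul0r mchar0 mul0r.
have [->|y0] := eqVneq y 0; first by rewrite mulr0 mchar0 mulr0.
by rewrite -(dlogP x0) -(dlogP y0) -exprD !mchar_gam exprD.
Qed.

Lemma norm_mchar a : (0 < d)%N -> a != 0 -> `|mchar w a| = 1.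
Proof.
move=> d0 a0; rewrite /mchar (negPf a0) normrX.
suff -> : `|w| = 1 by rewrite expr1n.
by apply/eqP; rewrite -(pexpr_eq1 d0) // -normrX wd normr1.
Qed.
End Order.
End Character.

Lemma sum_prim_root_expr (R : idomainType) (w : R) d :
  (1 < d)%N -> d.-primitive_root w -> \sum_(j < d) w ^+ j = 0.
Proof.
move=> d1 wp; have w1 : w - 1 != 0.
  rewrite subr_eq0 -[w]expr1 -(expr0 w) (eq_prim_root_expr wp).
  by rewrite mod0n modn_small.
apply: (mulfI w1); rewrite mulr0 -[LHS]opprK -mulNr opprB.
have := subrX1 w d; rewrite (prim_expr_order wp) subrr => /esym h.
by rewrite -opprB mulNr h !oppr0.
Qed.

Section Weil.
Variables (F : finFieldType) (K : closedFieldType) (iota : {rmorphism F -> K}).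
Variable gam : F.
Hypothesis gamP : (#|F|.-1).-primitive_root gam.
Local Notation q := #|F|.
Variables (d e1 : nat) (w : algC).
Hypothesis qE : q.-1 = (d * e1)%N.
Hypothesis d1 : (1 < d)%N.
Hypothesis wp : d.-primitive_root w.
Local Notation chi := (mchar gam w).
Local Notation "p ^i" := (map_poly iota p) (at level 2, format "p ^i").
Local Notation points := (subfield_points F K).
Local Notation chiK := (char_ext iota chi).
Variables P H : {poly F}.
Hypothesis P0 : P != 0.
Hypothesis H0 : H != 0.
Hypothesis PH : forall z, root P^i z = root H^i z.
Hypothesis ndP : nondegenerate P^i d.

Let dq : (d %| q.-1)%N. Proof. by rewrite qE dvdn_mulr. Qed.
Let wd : w ^+ d = 1. Proof. exact: prim_expr_order wp. Qed.
Let d0 : (0 < d)%N. Proof. exact: ltnW. Qed.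
Let e10 : (0 < e1)%N.
Proof.
have := finNzRing_gt1 F; have := qE; case: (e1) => //; rewrite muln0.
by case: (#|F|) => [|[]].
Qed.
Let chiM := mcharM gamP dq wd.
Let chi0 : chi 0 = 0 := mchar0 gam w.
Let zeta := iota (gam ^+ e1).

Let zetaP : d.-primitive_root zeta.
Proof.
rewrite fmorph_primitive_root; have := exp_prim_root gamP e1.
have g0 : gcdn e1 (d * e1) = e1 by apply/gcdn_idPl; rewrite dvdn_mull.
by rewrite qE g0 mulnK.
Qed.

Definition norm_exponent t := (\sum_(i < t) q ^ i)%N.

Lemma predn_expq t : (q ^ t)%N = (d * (e1 * norm_exponent t)).+1.
Proof.
rewrite mulnA -qE -predn_exp prednK // expn_gt0.
by rewrite (ltnW (finNzRing_gt1 F)).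
Qed.

Lemma norm_exponent_double t : norm_exponent (t + t) = (norm_exponent t * (q ^ t).+1)%N.
Proof.
rewrite /norm_exponent big_split_ord /= mulnSr addnC; congr (_ + _)%N.
by rewrite big_distrl /=; apply: eq_bigr => i _; rewrite expnD mulnC.
Qed.

(** For nonzero [y] the character of the norm of [y] only depends on the [d]-th
    root of unity [y^((q^(2t) - 1) / d)], which is one of the [zeta^j]; for [y = 0]
    both sides vanish. *)
Lemma chi_class t y : (0 < t)%N -> y ^+ (q ^ (t + t)) = y ->
  chiK (\prod_(i < t + t) y ^+ (q ^ i)) =
  \sum_(j < d) (y ^+ (e1 * norm_exponent t * (q ^ t).+1) == zeta ^+ j)%:R * w ^+ j.
Proof.
move=> t0 yQ; have k0 : (0 < norm_exponent t)%N.
  by rewrite /norm_exponent; case: (t) t0 => // t' _; rewrite big_ord_recl expn0.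
have prodE : \prod_(i < t + t) y ^+ (q ^ i) = y ^+ norm_exponent (t + t).
  by rewrite /norm_exponent; elim/big_rec2: _ => [|i a b _ ->]; rewrite ?expr0 ?exprD.
set E := (e1 * norm_exponent t * (q ^ t).+1)%N.
have E0 : (0 < E)%N by rewrite !muln_gt0 e10 k0.
have zj j : zeta ^+ j != 0.
  by rewrite expf_neq0 // fmorph_eq0 expf_neq0 // (gam_neq0 gamP).
have [y0|y0] := eqVneq y 0.
  rewrite [RHS]big1 => [|j _]; last first.
    by rewrite y0 expr0n gtn_eqF // eq_sym (negPf (zj j)) mul0r.
  have k20 : (0 < norm_exponent (t + t))%N by rewrite norm_exponent_double muln_gt0 k0.
  by rewrite prodE y0 expr0n gtn_eqF //= mulr0n -(rmorph0 iota) /char_ext unimageK chi0.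
have [a aE] : exists a, y ^+ norm_exponent (t + t) = iota a.
  apply: (fixed_in_image iota); apply: (mulfI y0).
  rewrite -exprM -exprS.
  have -> : (norm_exponent (t + t) * q).+1 = (q ^ (t + t) + norm_exponent (t + t))%N.
    rewrite mulnC -{1}(prednK (ltnW (finNzRing_gt1 F))) mulSn -predn_exp addnC -addSn prednK //.
    by rewrite expn_gt0 (ltnW (finNzRing_gt1 F)).
  by rewrite exprD yQ.
have a0 : a != 0 by rewrite -(fmorph_eq0 iota) -aE expf_neq0.
have yE : y ^+ E = zeta ^+ dlog gam a.
  have -> : E = (norm_exponent (t + t) * e1)%N by rewrite /E norm_exponent_double; lia.
  by rewrite exprM aE -[in LHS](dlogP gamP a0) -!rmorphXn /= -!exprM mulnC.
rewrite prodE aE /char_ext unimageK /mchar (negPf a0) yE.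
have ld : (dlog gam a %% d < d)%N by rewrite ltn_pmod.
rewrite (bigD1 (Ordinal ld)) //= (prim_expr_mod zetaP) eqxx mul1r.
rewrite (prim_expr_mod wp) big1 ?addr0 // => j jl.
rewrite (eq_prim_root_expr zetaP) (modn_small (ltn_ord j)).
case: eqP => [h|_]; last by rewrite mul0r.
by move: jl; rewrite -val_eqE /= h eqxx.
Qed.

Lemma poly_char_conj_eq0 t z : (0 < t)%N -> z \in points (t + t) ->
  (poly_char iota chi P (conj_poly iota (t + t) z) == 0) = root P^i z.
Proof.
move=> t0 zt; have tt0 : (0 < t + t)%N by rewrite addn_gt0 t0.
rewrite /poly_char root_prod_conj //.
under eq_bigr do rewrite -exprqX_horner.
set y := P^i.[z].
have yQ : y ^+ (q ^ (t + t)) = y.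
  by rewrite /y exprqX_horner; move: zt; rewrite mem_points // => /eqP ->.
have fx : (\prod_(i < t + t) y ^+ (q ^ i)) ^+ q = \prod_(i < t + t) y ^+ (q ^ i).
  rewrite -prodrXl; under eq_bigr do rewrite -exprM -expnSr.
  case: (t + t)%N tt0 yQ => // s _ yQ.
  rewrite [LHS]big_ord_recr [RHS]big_ord_recl /= yQ expn0 expr1 mulrC; congr (_ * _).
have [a aE] := fixed_in_image iota fx.
rewrite aE /char_ext unimageK /mchar /root -/y.
have -> : (y == 0) = (a == 0).
  rewrite -(fmorph_eq0 iota) -aE; apply/eqP/eqP => [->|].
    by apply/eqP/prodf_eq0; exists (Ordinal tt0); rewrite // expn0 expr1.
  by move/eqP/prodf_eq0 => [i _]; rewrite expf_eq0 => /andP [_ /eqP].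
have [_|a0] := eqVneq a 0; first by rewrite eqxx.
apply/negbTE; rewrite expf_neq0 //.
by apply/eqP => w0; move: wd; rewrite w0 expr0n gtn_eqF // => /esym/eqP; rewrite oner_eq0.
Qed.

Definition stepanov_const := (1 + d * (3 * (size P).-1 + 2) + (size P).-1)%N.

Lemma count_roots_points s : (0 < s)%N ->
  (count (root P^i) (points s) <= (size P).-1)%N.
Proof.
move=> s0; have Pi0 : P^i != 0 by rewrite map_poly_eq0.
rewrite -size_filter -ltnS prednK ?size_poly_gt0 // -(size_map_poly iota).
apply: max_poly_roots => //; first by apply/allP => z; rewrite mem_filter => /andP [].
exact: filter_uniq (uniq_points iota s0).
Qed.

(** Over the [d] classes of [chi_class] the weights [w^j] sum to zero, so only the
    deviations of the class sizes from a common value matter.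
    [stepanov_count] bounds each class from above, and since the classes
    together contain all but at most [deg P] points, also from below. *)
Lemma norm_sum_bound t : (2 * (d * (size P).-1 + 2) <= q ^ t)%N -> (0 < t)%N ->
  `|norm_sum iota chi P (t + t)| <= (stepanov_const * q ^ t)%:R.
Proof.
move=> hr t0; have tt0 : (0 < t + t)%N by rewrite addn_gt0 t0.
set r := (q ^ t)%N in hr *.
set m := (size P).-1 in hr.
pose E := (e1 * norm_exponent t * r.+1)%N.
pose cls j z := P^i.[z] ^+ E == zeta ^+ j.
pose N j := count (cls j) (points (t + t)).
pose T := (r * r + (1 + d * (3 * m + 2)) * r)%N.
have zj j : zeta ^+ j != 0.
  by rewrite expf_neq0 // fmorph_eq0 expf_neq0 // (gam_neq0 gamP).
have NT j : (d * N j <= T)%N.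
  rewrite /N -size_filter /T /m -(size_map_poly iota).
  apply: (@stepanov_count K P^i d (e1 * norm_exponent t) r (zeta ^+ j)).
  - exact: pnat_expq.
  - exact: predn_expq.
  - exact: ndP.
  - exact: d1.
  - by rewrite size_map_poly.
  - exact: zj.
  - exact: filter_uniq (uniq_points iota tt0).
  move=> z; rewrite mem_filter => /andP [/eqP hz zp]; split; last exact: hz.
  by move: zp; rewrite mem_points // -expnD => /eqP.
have sE : norm_sum iota chi P (t + t) = \sum_(j < d) (N j)%:R * w ^+ j.
  rewrite /norm_sum.
  transitivity (\sum_(z <- points (t + t)) \sum_(j < d) (cls j z)%:R * w ^+ j).
    rewrite big_seq [RHS]big_seq; apply: eq_bigr => z zp.
    rewrite /poly_char root_prod_conj //.
    under eq_bigr do rewrite -exprqX_horner.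
    rewrite chi_class //.
    by rewrite exprqX_horner; move: zp; rewrite mem_points // => /eqP ->.
  rewrite exchange_big /=; apply: eq_bigr => j _.
  by rewrite -mulr_suml -natr_sum sum_nat_bool_count.
have sN : (r * r <= \sum_(j < d) N j + m)%N.
  have -> : (r * r)%N = size (points (t + t)) by rewrite size_points // expnD.
  rewrite -(count_predC (root P^i)) addnC leq_add ?count_roots_points //.
  rewrite /N; under [leqRHS]eq_bigr do rewrite -sum_nat_bool_count.
  rewrite exchange_big -sum_nat_bool_count big_seq [leqRHS]big_seq /=.
  apply: leq_sum => z zp; rewrite -/(root _ _).
  case Pz: (root P^i z) => //=.
  have y0 : P^i.[z] != 0 by rewrite -rootE Pz.
  have yE : (P^i.[z] ^+ E) ^+ d = 1.
    apply: (mulfI y0); rewrite mulr1 -exprM -exprS.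
    have -> : (E * d).+1 = (q ^ (t + t))%N.
      by rewrite predn_expq norm_exponent_double /E; congr (_.+1); rewrite /r; lia.
    by rewrite exprqX_horner; move: zp; rewrite mem_points // => /eqP ->.
  have [j hj] := prim_rootP zetaP yE.
  by rewrite (bigD1 j) //= /cls hj eqxx.
have hd : d%:R * norm_sum iota chi P (t + t) = - \sum_(j < d) (T - d * N j)%N%:R * w ^+ j.
  have -> : \sum_(j < d) (T - d * N j)%N%:R * w ^+ j =
      T%:R * (\sum_(j < d) w ^+ j) - d%:R * \sum_(j < d) (N j)%:R * w ^+ j.
    rewrite !mulr_sumr -sumrB; apply: eq_bigr => j _.
    by rewrite natrB // natrM; ring.
  by rewrite (sum_prim_root_expr d1 wp) mulr0 sub0r opprK sE.
have nw : `|w| = 1.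
  by apply/eqP; rewrite -(pexpr_eq1 d0) // -normrX wd normr1.
have dR : (0 : algC) < d%:R by rewrite ltr0n.
rewrite -(ler_pM2l dR) -[X in X * `|_|]normr_nat -normrM hd normrN.
apply: le_trans (ler_norm_sum _ _ _) _.
under eq_bigr do rewrite normrM normr_nat normrX nw expr1n mulr1.
rewrite -natr_sum -natrM ler_nat.
have h1 : (\sum_(j < d) (T - d * N j) + d * \sum_(j < d) N j = d * T)%N.
  rewrite big_distrr -big_split /=.
  under eq_bigr do rewrite subnK ?NT //.
  by rewrite sum_nat_const card_ord.
have h2 : (d * (r * r) <= d * \sum_(j < d) N j + d * m)%N by rewrite -mulnDr leq_mul2l sN orbT.
have r1 : (1 <= r)%N by rewrite /r expn_gt0 (ltnW (finNzRing_gt1 F)).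
have h3 : (d * m <= d * (m * r))%N by rewrite leq_mul2l leq_pmulr ?orbT.
have h4 : (d * T = d * (r * r) + d * ((1 + d * (3 * m + 2)) * r))%N by rewrite /T mulnDr.
have h5 : (d * (stepanov_const * r) = d * ((1 + d * (3 * m + 2)) * r) + d * (m * r))%N.
  by rewrite /stepanov_const -/m mulnDl mulnDr.
have h6 : (\sum_(j < d) (T - d * N j) <= d * (stepanov_const * r))%N.
  rewrite h5; move: h1 h2 h3; rewrite h4.
  move: (d * \sum_(j < d) N j)%N (d * ((1 + d * (3 * m + 2)) * r))%N (d * (r * r))%N => s1
    s2 s3.
  lia.
exact: h6.
Qed.

Lemma norm_chi a : a != 0 -> `|chi a| = 1.
Proof. exact: (norm_mchar gam wd d0). Qed.

(** If [value_char] took only the values 0 and 1, the norm sums would have modulus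
    [q^(2t) - O(1)], which contradicts [norm_sum_bound] for large [t]. *)
Lemma exists_nontrivial_value_char : exists u, value_char iota chi P u != 0 /\ value_char
  iota chi P u != 1.
Proof.
pose m := (size P).-1; pose C := stepanov_const.
(* Large enough for the count to apply and for [q^(2t) - m > C q^t]. *)
pose t := (2 * (d * m + 2) + C + m + 1)%N.
have t0 : (0 < t)%N by rewrite /t; lia.
have tt0 : (0 < t + t)%N by rewrite addn_gt0 t0.
have tr : (t < q ^ t)%N by apply: ltn_expl; exact: finNzRing_gt1.
set r := (q ^ t)%N in tr.
have [/hasP [z _ /andP [h0 h1]]|] := boolP (has (fun z =>
   (value_char iota chi P (conj_poly iota (t + t) z) != 0) && (value_char iota chi P
     (conj_poly iota (t + t) z) != 1)) (points (t + t))).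
  by exists (conj_poly iota (t + t) z).
move/hasPn => h; exfalso.
pose kap : algC := chi (lead_coef P ^+ (t + t) * (-1) ^+ ((t + t) * m)).
have kap1 : `|kap| = 1.
  by rewrite norm_chi // mulf_neq0 ?expf_neq0 ?lead_coef_eq0 // oppr_eq0 oner_eq0.
have kap0 : kap != 0 by rewrite -normr_eq0 kap1 oner_eq0.
have hs : norm_sum iota chi P (t + t) = kap * (count (predC (root P^i)) (points (t + t)))%:R.
  rewrite -sum_nat_bool_count natr_sum mulr_sumr /norm_sum big_seq [RHS]big_seq.
  apply: eq_bigr => z zp; have := poly_char_conj_eq0 t0 zp.
  rewrite (poly_char_value iota chiM P0) ?conj_poly_monic // size_conj_poly //= -/kap.
  rewrite mulf_eq0 (negPf kap0) /= => <-; congr (_ * _).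
  have := h z zp; rewrite negb_and !negbK.
  by case: eqP => [-> //|_ /= /eqP ->].
have hr : (2 * (d * (size P).-1 + 2) <= q ^ t)%N by rewrite -/m -/r; rewrite /t in tr; lia.
have := norm_sum_bound hr t0.
rewrite -/r hs normrM kap1 mul1r normr_nat ler_nat -/C.
have := count_predC (root P^i) (points (t + t)).
rewrite size_points // expnD -/r; have := count_roots_points tt0; rewrite -/m.
move: (count _ _) (count _ _) => x y hx hy.
move=> hz.
have : (C * r + m < r * r)%N.
  apply: (@leq_trans ((C + m + 1) * r)%N); last by rewrite leq_mul2r; apply/orP; right;
    rewrite /t in tr; lia.
  rewrite !mulnDl mul1n -addnS -!addnA leq_add2l.
  have : (m <= m * r)%N by rewrite leq_pmulr // (leq_ltn_trans _ tr).
  have : (0 < r)%N by rewrite (leq_ltn_trans _ tr).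
  lia.
lia.
Qed.

(** In the application the exponents in [P] are as large as [q]; [H] carries the
    zeros of [P] with a small degree. *)
Theorem weil_bound :
  `|\sum_(a : F) chi P.[a]| <= (size H).-1.-1%:R * sqrtC q%:R.
Proof.
have [u [u0 u1]] := exists_nontrivial_value_char.
have q0 : (0 < q)%N by apply: ltnW; exact: finNzRing_gt1.
have -> : \sum_(a : F) chi P.[a] = norm_sum iota chi P 1.
  rewrite /norm_sum.
  have pp : perm_eq (points 1) [seq iota a | a <- enum F].
    apply: uniq_perm => [||z]; first exact: (uniq_points iota (s := 1)).
      by rewrite map_inj_uniq ?enum_uniq //; exact: fmorph_inj.
    rewrite mem_points // expn1; apply/eqP/mapP => [/(fixed_in_image iota) [a ->]|[a _ ->]].
      by exists a; rewrite ?mem_enum.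
    exact: image_fixed.
  rewrite (perm_big _ pp) big_map /= big_enum /=; apply: eq_bigr => a _.
  rewrite /poly_char root_prod_conj ?(perm_mem pp) ?map_f ?mem_enum //.
  by rewrite big_ord1 expn0 expr1 horner_map /char_ext unimageK.
pose m := (size P).-1.
pose k0 := (2 * (d * m + 2))%N.
apply: (l_function_bound (c := lcoef iota chi P) (S := norm_sum iota chi P)
    (C := stepanov_const%:R) (t := 2) (k0 := k0.+1)).
- rewrite /lcoef (big_pred1 0) => [|v]; last by apply/esym/eqP/rowP; case.
  rewrite /monic_of linear0 addr0 expr0; exact: (poly_char1 iota (mchar1 gamP dq wd)).
- by move=> n; apply: (lcoef_eq0 chi0 chiM P0 H0 PH u0 u1).
- by move=> n; rewrite (newton_lcoef iota chiM).
- by rewrite sqrtC_gt0 ltr0n.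
- by [].
move=> k hk; have -> : (2 * k = k + k)%N by lia.
rewrite addnn -muln2 mulnC exprM sqrtCK -natrX -natrM mulnC muln2 -addnn.
apply: norm_sum_bound; last by apply: leq_ltn_trans hk.
apply: leq_trans (ltnW (ltn_expl k (finNzRing_gt1 F))).
exact: ltnW.
Qed.
End Weil.

(** * Character sums over the pairs (x, f(x)) *)

Section Descent.
Variables (F : finFieldType) (K : closedFieldType) (iota : {rmorphism F -> K}).
Local Notation q := #|F|.
Local Notation "p ^i" := (map_poly iota p) (at level 2, format "p ^i").

(** The [D]-th root is first built over the closure as a product over the nonzero
    roots; the multiplicities being Frobenius-invariant, it is defined over
    [F]. *)
Lemma power_descent (f : {poly F}) D : f != 0 -> (0 < D)%N ->
  (forall z, z != 0 -> (D %| mup z f^i)%N) ->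
  exists c m g, [/\ c != 0, g != 0 & f = c%:P * 'X^m * g ^+ D].
Proof.
move=> f0 D0 hD; have fi0 : f^i != 0 by rewrite map_poly_eq0.
pose U := [seq z <- undup (roots_list f^i) | z != 0].
pose gK : {poly K} := \prod_(z <- U) ('X - z%:P) ^+ (mup z f^i %/ D).
have Uu : uniq U by rewrite filter_uniq ?undup_uniq.
have memU z : (z \in U) = (z != 0) && root f^i z.
  by rewrite mem_filter mem_undup mem_roots_list.
have Uq : perm_eq [seq z ^+ q | z <- U] U.
  have uq : uniq [seq z ^+ q | z <- U].
    by rewrite map_inj_uniq //; exact: (frq_inj iota).
  have sub : {subset [seq z ^+ q | z <- U] <= U}.
    move=> x /mapP [z]; rewrite memU => /andP [z0 /eqP hz] ->.
    rewrite memU expf_neq0 //= /root -exprq_horner hz expr0n gtn_eqF //.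
    exact: ltnW (finNzRing_gt1 F).
  have [_ h] := uniq_min_size uq sub (eq_leq (esym (size_map _ _))).
  exact: uniq_perm.
have gq : map_poly (frq iota) gK = gK.
  rewrite {1}/gK rmorph_prod /=.
  transitivity (\prod_(z <- [seq z ^+ q | z <- U]) ('X - z%:P) ^+ (mup z f^i %/ D)).
    rewrite big_map; apply: eq_bigr => z _.
    by rewrite rmorphXn rmorphB /= map_polyX map_polyC /= mup_frq.
  exact: perm_big.
have gK0 : gK != 0.
  rewrite /gK; elim/big_rec: _ => [|z p _ p0]; first exact: oner_neq0.
  by rewrite mulf_neq0 // expf_neq0 // polyXsubC_eq0.
pose g := unmap_poly iota gK.
have gE : g^i = gK by exact: unmap_polyP.
exists (lead_coef f), (mup 0 f^i), g; split.
- by rewrite lead_coef_eq0.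
- by rewrite -(map_poly_eq0 iota) gE.
apply: (map_poly_inj iota).
rewrite !rmorphM !rmorphXn /= map_polyX map_polyC /= gE.
rewrite {1}[f^i]roots_listE lead_coef_map -mul_polyC -mulrA; congr (_ * _).
have -> : \prod_(z <- roots_list f^i) ('X - z%:P) = \prod_(z <- undup (roots_list f^i)) ('X
  - z%:P) ^+ (mup z f^i).
  rewrite -(big_undup_iterop_count _ (roots_list f^i) xpredT) /=.
  apply: eq_bigr => z _; rewrite Monoid.iteropE -/(_ ^+ _) count_roots_list //.
  elim: (mup _ _) => [|k IH]; first by rewrite expr0.
  by rewrite exprS iterS -IH.
rewrite (bigID (fun z => z != 0)) /= mulrC; congr (_ * _).
  under eq_bigl do rewrite negbK.
  have [h0|h0] := boolP (0 \in undup (roots_list f^i)).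
    rewrite -big_filter.
    have -> : [seq z <- undup (roots_list f^i) | z == 0] = [:: 0].
      apply: perm_small_eq => //; apply: uniq_perm; rewrite ?filter_uniq ?undup_uniq //.
      by move=> z; rewrite mem_filter inE; case: eqP => [->|].
    by rewrite big_seq1 subr0.
  rewrite big1_seq => [|z /andP [/eqP -> h]]; last by rewrite h in h0.
  rewrite mupNroot ?expr0 //.
  by move: h0; rewrite mem_undup mem_roots_list.
rewrite -big_filter -/U /gK -prodrXl; apply: eq_big_seq => z.
rewrite memU => /andP [z0 _].
by rewrite -exprM divnK // hD.
Qed.
End Descent.

Lemma rootX_pos (K : fieldType) (p : {poly K}) k z : (0 < k)%N -> root (p ^+ k) z = root p z.
Proof. by move=> k0; rewrite /root horner_exp expf_eq0 k0. Qed.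

Lemma divf_mul3 (L : fieldType) (a b c x y z : L) :
  a * b * c / (x * y * z) = a / x * (b / y) * (c / z).
Proof. by rewrite !invfM; ring. Qed.

Section PairSums.
Variables (F : finFieldType) (gam : F).
Hypothesis gamP : (#|F|.-1).-primitive_root gam.
Local Notation q := #|F|.
Local Notation N := (#|F|.-1).
Variable w : algC.
Hypothesis wp : N.-primitive_root w.
Variables (f : ratfun F) (f1 f2 : {poly F}).
Hypothesis flow : lowest_terms f f1 f2.
Hypothesis fne : ~ exceptional f.

Let f10 : f1 != 0. Proof. by case: flow. Qed.
Let f20 : f2 != 0. Proof. by case: flow => _ /monic_neq0. Qed.
Let q1 : (1 < q)%N. Proof. exact: finNzRing_gt1. Qed.
Let N0 : (0 < N)%N. Proof. exact: prim_order_gt0 wp. Qed.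
Let wN : w ^+ N = 1. Proof. exact: prim_expr_order. Qed.

Let n := ((size f1).-1 + (size f2).-1)%N.

Section Closure.
Variables (K : closedFieldType) (iota : {rmorphism F -> K}).
Local Notation "p ^i" := (map_poly iota p) (at level 2, format "p ^i").

Lemma exceptional_of_mup D : (1 < D)%N -> (D %| N)%N ->
  (forall z, z != 0 -> (D %| mup z f1^i)%N /\ (D %| mup z f2^i)%N) -> exceptional f.
Proof.
move=> D1 DN h; have D0 := ltnW D1.
have [c1 [m1 [g1 [c10 g10 f1E]]]] := power_descent f10 D0 (fun z z0 => (h z z0).1).
have [c2 [m2 [g2 [c20 g20 f2E]]]] := power_descent f20 D0 (fun z z0 => (h z z0).2).
exists (c1 / c2), (m1%:Z - m2%:Z), (tofrac g1 / tofrac g2), D; split=> //.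
  by rewrite mulf_neq0 // invr_eq0.
case: flow => _ _ _ ->; rewrite f1E f2E.
have X0 : tofrac ('X : {poly F}) != 0 by rewrite tofrac_eq0 polyX_eq0.
have C0 (c : F) : c != 0 -> tofrac c%:P != 0 by rewrite tofrac_eq0 polyC_eq0.
have -> : tofrac (c1 / c2)%:P = tofrac c1%:P / tofrac c2%:P.
  apply: (canRL (mulfK (C0 _ c20))); rewrite -tofracM -polyCM; congr (tofrac _%:P).
  by rewrite divfK.
rewrite expfzDr // -exprnN -!exprnP expr_div_n.
rewrite !tofracM !tofracXn; exact: divf_mul3.
Qed.

(** If [d] divided [j] times all multiplicities, [D = N / gcd(N, j b)] would divide
    all the multiplicities of [f1] and [f2] outside 0.  When [D > 1] this makes
    [f] exceptional; when [D = 1] the multiplicity at 0 shows that [N] divides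
    both [j a] and [j b], hence [j e], which is impossible for [j < d]. *)
Lemma nondegenerate_twist a b e d :
  (0 < a)%N -> (0 < b)%N -> (b < N)%N -> N = (e * d)%N ->
  e = gcdn a (gcdn b N) ->
  nondegenerate ('X ^+ (a %/ e) * f1 ^+ (b %/ e) * f2 ^+ ((N - b) %/ e))^i d.
Proof.
move=> a0 b0 bN Ned eE j /andP [j0 jd].
have ea : (e %| a)%N by rewrite eE dvdn_gcdl.
have eb : (e %| b)%N by rewrite eE (dvdn_trans (dvdn_gcdr _ _)) ?dvdn_gcdl.
have eN : (e %| N)%N by rewrite Ned dvdn_mulr.
have eNb : (e %| N - b)%N by rewrite dvdn_sub.
have e0 : (0 < e)%N by rewrite eE gcdn_gt0 a0.
set P := (_ * _ * _)^i.
have f1i : f1^i != 0 by rewrite map_poly_eq0.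
have f2i : f2^i != 0 by rewrite map_poly_eq0.
have X0 : ('X : {poly K}) != 0 by rewrite polyX_eq0.
have PE : P = 'X ^+ (a %/ e) * f1^i ^+ (b %/ e) * f2^i ^+ ((N - b) %/ e).
  by rewrite /P !rmorphM !rmorphXn /= map_polyX.
have P0 : P != 0 by rewrite PE !mulf_neq0 ?expf_neq0.
have mE z : mup z P = (a %/ e * (z == 0%R) + b %/ e * mup z f1^i + (N - b) %/ e * mup z f2^i)%N.
  rewrite PE !mupM ?mulf_neq0 ?expf_neq0 // !mup_exp //; congr (_ * _ + _ + _)%N.
  by rewrite -['X]subr0 (@mup_XsubCX K 1) eq_sym; case: eqP.
case: (boolP (has (fun z => ~~ (d %| j * mup z P)%N) (roots_list P))) => [/hasP [z _ hz]|].
  by exists z.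
move/hasPn => hz; exfalso.
have {}hz z : (d %| j * mup z P)%N.
  have [|] := boolP (z \in roots_list P); first by move/hz; rewrite negbK.
  by rewrite mem_roots_list // => /mupNroot ->; rewrite muln0.
have hN z : (N %| j * (a * (z == 0%R) + b * mup z f1^i + (N - b) * mup z f2^i))%N.
  have : (N %| j * mup z P * e)%N by rewrite Ned mulnC dvdn_pmul2r.
  rewrite mE; apply: etrans; congr (_ %| _)%N; rewrite -mulnA; congr (_ * _)%N.
  by rewrite !mulnDl ![(_ * _ * e)%N]mulnAC !divnK.
have cop z : mup z f1^i = 0%N \/ mup z f2^i = 0%N.
  have [r1|] := boolP (root f1^i z); last by move/mupNroot; left.
  right; apply: mupNroot; apply: coprimep_root r1.
  by rewrite coprimep_map; case: flow.
have h1 z : z != 0 -> (N %| j * b * mup z f1^i)%N.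
  move=> z0; have := hN z; rewrite (negPf z0) muln0 add0n.
  case: (cop z) => ->; first by rewrite !muln0.
  by rewrite muln0 addn0 mulnA.
have h2 z : z != 0 -> (N %| j * b * mup z f2^i)%N.
  move=> z0; have := hN z; rewrite (negPf z0) muln0 add0n.
  case: (cop z) => ->; last by rewrite !muln0.
  rewrite muln0 add0n => h; have : (N %| j * N * mup z f2^i)%N.
    by rewrite -mulnA mulnCA dvdn_mulr.
  have -> : (j * N = j * b + j * (N - b))%N by rewrite -mulnDr subnKC // ltnW.
  by rewrite mulnDl dvdn_addl // -mulnA.
pose D := (N %/ gcdn N (j * b))%N.
have DN : (D * gcdn N (j * b) = N)%N by rewrite divnK ?dvdn_gcdl.
have g0 : (0 < gcdn N (j * b))%N by rewrite gcdn_gt0 N0.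
have hD m : (N %| j * b * m)%N -> (D %| m)%N.
  have jbE : (j * b = (j * b %/ gcdn N (j * b)) * gcdn N (j * b))%N by rewrite divnK ?dvdn_gcdr.
  move=> h; have : (D * gcdn N (j * b) %| (j * b %/ gcdn N (j * b)) * m * gcdn N (j * b))%N.
    by rewrite DN mulnAC -jbE.
  rewrite dvdn_pmul2r // Gauss_dvdr //.
  by rewrite /D /coprime -(eqn_pmul2r g0) muln_gcdl -jbE !divnK ?dvdn_gcdl ?dvdn_gcdr // mul1n.
have [D1|D1] := leqP D 1.
  have {D1} : N = gcdn N (j * b).
    have D1' : D = 1%N by apply/eqP; rewrite eqn_leq D1 divn_gt0 // dvdn_leq ?dvdn_gcdl.
    by rewrite -[LHS]DN D1' mul1n.
  move=> Ng; have Njb : (N %| j * b)%N by rewrite {1}Ng dvdn_gcdr.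
  have Nja : (N %| j * a)%N.
    have := hN 0; rewrite eqxx muln1 mulnDr mulnDr -addnA dvdn_addl //.
    rewrite dvdn_add // mulnA dvdn_mulr //.
    by rewrite mulnBr dvdn_sub // dvdn_mull.
  have : (N %| j * e)%N.
    by rewrite eE !muln_gcdr !dvdn_gcd Nja Njb dvdn_mull.
  rewrite Ned mulnC dvdn_pmul2r // => /(dvdn_leq j0).
  by rewrite leqNgt jd.
apply: fne; apply: (exceptional_of_mup D1); first by rewrite -[X in (_ %| X)%N]DN dvdn_mulr.
by move=> z z0; split; apply: hD; [apply: h1|apply: h2].
Qed.
End Closure.

Local Notation ch t := (mchar gam (w ^+ t)).
(** At a pole the value is 0, as division by 0 yields 0; poles then drop out of all
    the character sums like the zeros do. *)
Definition ratval x := f1.[x] / f2.[x].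
Definition pair_sum a b : algC := \sum_(x : F) ch a x * ch b (ratval x).

Lemma expw t : (w ^+ t) ^+ N = 1.
Proof. by rewrite exprAC wN expr1n. Qed.

Let chg t k : ch t (gam ^+ k) = w ^+ (t * k).
Proof. by rewrite (mchar_gam gamP (dvdnn _) (expw t)) exprM. Qed.

Lemma ch_modn t : ch (t %% N) =1 ch t.
Proof. by move=> x; rewrite /mchar (prim_expr_mod wp). Qed.

Lemma size_pred_gt0 (p : {poly F}) : p != 0 -> ((size p).-1.+1 = size p)%N.
Proof. by move=> p0; rewrite prednK // size_poly_gt0. Qed.

Lemma root_mul_size : (size (f1 * f2)%R).-1 = n.
Proof.
by rewrite size_mul // /n -(size_pred_gt0 f10) -(size_pred_gt0 f20); lia.
Qed.

(** Dividing the exponents by [e = gcd(a, b, N)] makes the character have exact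
    order [d = N / e]; the zeros of [P] are those of [X f1 f2], of degree
    [n + 1]. *)
Lemma pair_sum_weil a b : ~~ (N %| b)%N -> `|pair_sum a b| <= n%:R * sqrtC q%:R.
Proof.
move=> Nb; have [K [iota _]] := countable_algebraic_closure F.
wlog [a0 b0 bN] : a b Nb / [/\ (0 < a)%N, (0 < b)%N & (b < N)%N].
  move=> hw; have := hw (a %% N + N)%N (b %% N)%N.
  rewrite /dvdn modn_mod addn_gt0 N0 orbT lt0n ltn_pmod // => /(_ Nb) h.
  have {h} := h (And3 isT Nb isT); congr (_ <= _); congr `|_|.
  apply: eq_bigr => x _; rewrite ch_modn; congr (_ * _).
  by rewrite -ch_modn modnDr modn_mod ch_modn.
pose e := gcdn a (gcdn b N); pose d := (N %/ e)%N.
have ea : (e %| a)%N by rewrite dvdn_gcdl.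
have eb : (e %| b)%N by rewrite (dvdn_trans (dvdn_gcdr _ _)) ?dvdn_gcdl.
have eN : (e %| N)%N by rewrite (dvdn_trans (dvdn_gcdr _ _)) ?dvdn_gcdr.
have eNb : (e %| N - b)%N by rewrite dvdn_sub.
have e0 : (0 < e)%N by rewrite gcdn_gt0 a0.
have Ned : N = (e * d)%N by rewrite mulnC divnK.
have Nde : N = (d * e)%N by rewrite divnK.
have d1 : (1 < d)%N.
  rewrite ltn_divRL // mul1n; apply: leq_ltn_trans bN; exact: dvdn_leq.
have wep : d.-primitive_root (w ^+ e).
  have := exp_prim_root wp e; suff -> : gcdn e N = e by [].
  exact/gcdn_idPl.
pose P := 'X ^+ (a %/ e) * f1 ^+ (b %/ e) * f2 ^+ ((N - b) %/ e) : {poly F}.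
pose H := 'X * (f1 * f2) : {poly F}.
have X0 : ('X : {poly F}) != 0 by rewrite polyX_eq0.
have P0 : P != 0 by rewrite !mulf_neq0 ?expf_neq0.
have H0 : H != 0 by rewrite !mulf_neq0.
have ae0 : (0 < a %/ e)%N by rewrite divn_gt0 // dvdn_leq.
have be0 : (0 < b %/ e)%N by rewrite divn_gt0 // dvdn_leq.
have Nb0 : (0 < N - b)%N by rewrite subn_gt0.
have ne0 : (0 < (N - b) %/ e)%N by rewrite divn_gt0 // dvdn_leq.
have PH z : root (map_poly iota P) z = root (map_poly iota H) z.
  by rewrite /P /H !rmorphM !rmorphXn /= !rootM !rootX_pos // orbA.
have ndP := nondegenerate_twist iota a0 b0 bN Ned (erefl _).
have := weil_bound gamP Nde d1 wep P0 H0 PH ndP.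
have -> : (size H).-1.-1 = n.
  by rewrite /H mulrC size_mulX ?mulf_neq0 //= root_mul_size.
congr (`|_| <= _); apply: eq_bigr => x _.
have we : (w ^+ e) ^+ d = 1 by exact: prim_expr_order.
have dN : (d %| N)%N by rewrite Nde dvdn_mulr.
rewrite /P !hornerE /ratval.
have [->|x0] := eqVneq x 0.
  by rewrite expr0n gtn_eqF // !mul0r !mchar0 mul0r.
have [->|y0] := eqVneq f1.[x] 0.
  by rewrite expr0n gtn_eqF // mulr0 !mul0r !mchar0 mulr0.
have [->|z0] := eqVneq f2.[x] 0.
  by rewrite expr0n gtn_eqF // invr0 !mulr0 !mchar0 mulr0.
set y := f1.[x] in y0 *; set z := f2.[x] in z0 *.
have w0 : w != 0.
  by apply/eqP => h; move: wN; rewrite h expr0n gtn_eqF // => /esym/eqP; rewrite oner_eq0.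
have chz : ch b z != 0 by rewrite -(dlogP gamP z0) chg expf_neq0.
apply: (mulIf chz); rewrite -[RHS]mulrA -(mcharM gamP (dvdnn _) (expw b)) divfK //.
rewrite -(dlogP gamP x0) -(dlogP gamP y0) -(dlogP gamP z0) -!exprM -!exprD.
rewrite !chg -!exprD; apply/eqP; rewrite (eq_prim_root_expr wp).
set i := dlog gam x; set j := dlog gam y; set k := dlog gam z.
have -> : (e * (i * (a %/ e) + j * (b %/ e) + k * ((N - b) %/ e)) + b * k =
   a * i + b * j + N * k)%N.
  rewrite !mulnDr ![(e * (_ * _))%N]mulnCA ![(e * (_ %/ _))%N]mulnC !divnK //.
  have -> : (N * k = (N - b) * k + b * k)%N by rewrite -mulnDl subnK // ltnW.
  move: (N - b)%N i j k => M i j k. clear; lia.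
by rewrite addnC [(N * k)%N]mulnC modnMDl.
Qed.

Lemma count_bad : (#|[pred x : F | ratval x == 0%R]| <= n)%N.
Proof.
rewrite -root_mul_size cardE; have h : f1 * f2 != 0 by rewrite mulf_neq0.
rewrite -ltnS size_pred_gt0 //; apply: max_poly_roots => //; last exact: enum_uniq.
apply/allP => x; rewrite mem_enum inE /ratval mulf_eq0 invr_eq0 rootM.
by rewrite /root.
Qed.

Lemma sqrtq_ge1 : 1 <= sqrtC (q%:R : algC).
Proof. by rewrite -[X in X <= _]sqrtC1 ler_sqrtC ?nnegrE ?ler0n ?ler01 // ler1n;
  exact: ltnW. Qed.

Lemma sum_ch a : ~~ (N %| a)%N -> \sum_(x : F) ch a x = 0.
Proof.
move=> Na; have g0 := gam_neq0 gamP.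
have wa : w ^+ a != 1.
  by rewrite -(expr0 w) (eq_prim_root_expr wp) mod0n.
apply/eqP; move: wa; apply: contraNT => S0; apply/eqP; apply: (mulIf S0).
rewrite mul1r mulr_sumr [RHS](reindex_inj (mulfI g0)) /=; apply: eq_bigr => x _.
by rewrite (mcharM gamP (dvdnn _) (expw a)); have := chg a 1; rewrite expr1 muln1 => ->.
Qed.

Lemma norm_ch_le a x : `|ch a x| <= 1.
Proof.
have [->|x0] := eqVneq x 0; first by rewrite mchar0 normr0 ler01.
by rewrite (norm_mchar gam (expw a)).
Qed.

(** The complete sum of a nontrivial character vanishes, so only the at most [n]
    zeros and poles of [f] remain. *)
Lemma pair_sum_trivial a b : (N %| b)%N -> ~~ (N %| a)%N ->
  `|pair_sum a b| <= n%:R * sqrtC q%:R.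
Proof.
move=> /dvdnP [k ->] Na.
apply: le_trans (_ : n%:R <= _); last by rewrite ler_peMr ?ler0n ?sqrtq_ge1.
have wb : w ^+ (k * N) = 1 by rewrite mulnC exprM wN expr1n.
have -> : pair_sum a (k * N) = - \sum_(x | ratval x == 0) ch a x.
  have := sum_ch Na; rewrite (bigID (fun x => ratval x == 0)) /= addrC => /eqP.
  rewrite addr_eq0 => /eqP <-; rewrite /pair_sum (bigID (fun x => ratval x == 0)) /=.
  rewrite big1 ?add0r => [|x /eqP ->]; last by rewrite mchar0 mulr0.
  apply: eq_bigr => x hx.
  by rewrite wb {2}/mchar (negPf hx) expr1n mulr1.
rewrite normrN; apply: le_trans (ler_norm_sum _ _ _) _.
apply: le_trans (_ : \sum_(x | ratval x == 0) 1 <= _).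
  by apply: ler_sum => x _; apply: norm_ch_le.
by rewrite sumr_const ler_nat; exact: count_bad.
Qed.

Theorem pair_sum_bound a b : ~~ ((N %| a)%N && (N %| b)%N) ->
  `|pair_sum a b| <= n%:R * sqrtC q%:R.
Proof.
have [Nb|Nb _] := boolP (N %| b)%N; last exact: pair_sum_weil.
by rewrite andbT; exact: pair_sum_trivial.
Qed.

Lemma pair_sum00 : (q - 1 - n)%:R <= pair_sum 0 0.
Proof.
have -> : pair_sum 0 0 = #|[pred x : F | (x != 0) && (ratval x != 0)]|%:R.
  rewrite -sum1_card natr_sum /pair_sum [RHS]big_mkcond /=; apply: eq_bigr => x _.
  rewrite /mchar !expr0 !expr1n !inE.
  by case: eqP; case: eqP; rewrite /= ?mul0r ?mulr0 ?mul1r.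
rewrite ler_nat.
pose A := [pred x : F | x != 0%R]; pose B := [pred x : F | ratval x == 0].
have cA : #|A| = (q - 1)%N.
  by rewrite subn1 -(cardC1 (0 : F)); apply: eq_card => x; rewrite !inE.
have h1 : (#|[predI A & B]| <= n)%N.
  apply: leq_trans (count_bad); apply: subset_leq_card; apply/subsetP => x.
  by rewrite !inE => /andP [].
have h2 : #|[predD A & B]| = #|[pred x : F | (x != 0) && (ratval x != 0)]|.
  by apply: eq_card => x; rewrite !inE andbC.
by rewrite -h2 -cA -(cardID B A) leq_subLR leq_add2r.
Qed.
End PairSums.

(** * The prime sieve *)

Lemma prim_root_primitive_element (F : finFieldType) (a : F) :
  (#|F|.-1).-primitive_root a -> primitive_element a.
Proof.
move=> ap; have N0 := prim_order_gt0 ap.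
have a0 : a != 0.
  by apply/eqP => h; move: (prim_expr_order ap); rewrite h expr0n gtn_eqF // => /esym/eqP;
    rewrite oner_eq0.
have ua : a \is a GRing.unit by rewrite unitfE.
exists (FinRing.unit F ua) => //.
rewrite /generator eq_sym eqEcard subsetT /= card_finField_unit.
apply: dvdn_leq; first exact: order_gt0.
rewrite (prim_order_dvd ap).
have := congr1 val (expg_order (FinRing.unit F ua)).
by rewrite FinRing.val_unitX /= => ->.
Qed.

Section Sieve.
Variables (F : finFieldType) (gam : F).
Hypothesis gamP : (#|F|.-1).-primitive_root gam.
Local Notation q := #|F|.
Local Notation N := (#|F|.-1).
Variable w : algC.
Hypothesis wp : N.-primitive_root w.
Local Notation ch t := (mchar gam (w ^+ t)).
Variable phi : F -> F.

Let N0 : (0 < N)%N. Proof. exact: prim_order_gt0 wp. Qed.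
Let wN : w ^+ N = 1. Proof. exact: prim_expr_order. Qed.

Implicit Type s : seq (algC * nat).

(** A list of pairs (coefficient, exponent) stands for a combination of the
    characters [ch t]; lists rather than functions on exponents make the
    l1 norm immediate for products. *)
Definition char_eval s x : algC := \sum_(t <- s) t.1 * ch t.2 x.
Definition char_norm s : algC := \sum_(t <- s) `|t.1|.

Lemma char_eval0 s : char_eval s 0 = 0.
Proof. by rewrite /char_eval big1 // => t _; rewrite mchar0 mulr0. Qed.

Lemma char_eval_cat s1 s2 x : char_eval (s1 ++ s2) x = char_eval s1 x + char_eval s2 x.
Proof. exact: big_cat. Qed.

Lemma char_norm_cat s1 s2 : char_norm (s1 ++ s2) = char_norm s1 + char_norm s2.
Proof. exact: big_cat. Qed.

Lemma char_norm_cons t s : char_norm (t :: s) = `|t.1| + char_norm s.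
Proof. exact: big_cons. Qed.

(** The average of the nontrivial characters of order [l]: it is 1 on [l]-th powers
    and [-1 / (l - 1)] elsewhere, see [free_indicator]. *)
Definition power_residue l x : algC := (l.-1)%:R^-1 * \sum_(k <- iota 1 l.-1) ch (k * (N %/
  l)) x.

Definition residue_terms l s :=
  [seq (- (t.1 / (l.-1)%:R), (t.2 + k * (N %/ l))%N) | t <- s, k <- iota 1 l.-1].

Lemma chD t1 t2 x : x != 0 -> ch (t1 + t2) x = ch t1 x * ch t2 x.
Proof. by move=> x0; rewrite /mchar (negPf x0) exprD exprMn. Qed.

Lemma char_eval_residue l s x : x != 0 ->
  char_eval (residue_terms l s) x = - (char_eval s x * power_residue l x).
Proof.
move=> x0; rewrite /char_eval /residue_terms big_allpairs_dep /= mulr_suml -sumrN.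
apply: eq_bigr => t _; rewrite /power_residue.
under eq_bigr do rewrite chD //.
rewrite -[RHS]mulrN -mulrA -mulrN; rewrite !mulr_sumr.
rewrite -sumrN !mulr_sumr; apply: eq_bigr => k _; ring.
Qed.

Lemma char_norm_residue l s : (1 < l)%N -> char_norm (residue_terms l s) = char_norm s.
Proof.
move=> l1; rewrite /char_norm /residue_terms big_allpairs_dep /=.
apply: eq_bigr => t _; rewrite big_const_seq iter_addr_0 count_predT size_iota.
rewrite normrN normrM normfV normr_nat -[LHS]mulr_natr divfK //.
by rewrite pnatr_eq0; case: l l1 => [|[]].
Qed.

(** [free_terms L] expands the product over [l] in [L] of [1 - power_residue l];
    [free_rest L] are its terms other than the trivial character. *)
Fixpoint free_rest (L : seq nat) :=
  if L is l :: L' then free_rest L' ++ residue_terms l ((1, 0%N) :: free_rest L') else [::].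
Definition free_terms L := (1, 0%N) :: free_rest L.

Lemma free_termsE L x : x != 0 ->
  char_eval (free_terms L) x = \prod_(l <- L) (1 - power_residue l x).
Proof.
move=> x0; elim: L => [|l L IH].
  by rewrite /free_terms /char_eval big_seq1 big_nil mul1r /mchar (negPf x0) expr0 expr1n.
have -> : free_terms (l :: L) = free_terms L ++ residue_terms l (free_terms L) by [].
by rewrite char_eval_cat char_eval_residue // big_cons -IH; ring.
Qed.

Lemma char_norm_rest L : all (leq 2) L -> char_norm (free_rest L) = 2 ^+ size L - 1.
Proof.
elim: L => [|l L IH] /=; first by rewrite /char_norm big_nil expr0 subrr.
case/andP => l1 /IH {}IH; rewrite char_norm_cat char_norm_residue //.
by rewrite char_norm_cons IH normr1 exprS; ring.
Qed.

Lemma char_norm_free L : all (leq 2) L -> char_norm (free_terms L) = 2 ^+ size L.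
Proof.
by move=> h; rewrite char_norm_cons normr1 char_norm_rest //; ring.
Qed.

Definition nontrivial s := all (fun t => ~~ (N %| t.2)%N) s.

Lemma free_terms_dvd L : all (fun l => l %| N)%N L ->
  all (fun t => N %| t.2 * \prod_(l <- L) l)%N (free_terms L).
Proof.
elim: L => [|l L IH] /=; first by rewrite mul0n dvdn0.
case/andP => lN /IH /= /andP [_ h].
rewrite mul0n dvdn0 /= all_cat; apply/andP; split.
  by apply: sub_all h => t; rewrite big_cons mulnCA => ht; rewrite dvdn_mull.
apply/allP => u /allpairsPdep [t [k [ht hk ->]]] /=.
rewrite big_cons mulnDl dvdn_add //.
  rewrite mulnCA dvdn_mull //; move: ht; rewrite inE => /orP [/eqP ->|ht];
    first by rewrite mul0n dvdn0.
  exact: (allP h).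
by rewrite mulnA -[(k * _ * l)%N]mulnA divnK // mulnAC dvdn_mull.
Qed.

(** The exponents in [free_terms L] have order dividing the product of [L]; adding
    [k N / l] with [0 < k < l] introduces a component of order [l]. *)
Lemma nontrivial_residue l L : prime l -> l \notin L -> all prime L -> (l %| N)%N ->
  all (fun l => l %| N)%N L -> nontrivial (residue_terms l (free_terms L)).
Proof.
move=> pl lL pL lN LN; apply/allP => u /allpairsPdep [t [k [ht hk ->]]] /=.
apply/negP => h; have hd := allP (free_terms_dvd LN) _ ht.
have Nl : (0 < N %/ l)%N by rewrite divn_gt0 ?prime_gt0 // dvdn_leq.
have : (N %/ l * l %| N %/ l * (k * \prod_(l <- L) l))%N.
  rewrite divnK // mulnA [(_ %/ _ * k)%N]mulnC.
  by rewrite -(dvdn_addr _ hd) -mulnDl dvdn_mulr.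
rewrite dvdn_pmul2l // Euclid_dvdM //.
move: hk; rewrite mem_iota add1n (prednK (prime_gt0 pl)) => /andP [k0 kl].
rewrite gtnNdvd //= => hP; move: lL; apply/negP; rewrite negbK.
elim: (L) pL hP {LN hd ht} => [|a L' IH] /=; first by rewrite big_nil Euclid_dvd1.
case/andP => pa pL'; rewrite big_cons Euclid_dvdM // inE => /orP [|/(IH pL') ->];
  last by rewrite orbT.
by rewrite dvdn_prime2 // => ->.
Qed.

Lemma nontrivial_rest L : uniq L -> all prime L -> all (fun l => l %| N)%N L ->
  nontrivial (free_rest L).
Proof.
elim: L => [|l L IH] //= /andP [lL uL] /andP [pl pL] /andP [lN LN].
by rewrite /nontrivial all_cat -!/(nontrivial _) IH // nontrivial_residue.
Qed.

Lemma sum_iota_root (z : algC) l : (1 < l)%N -> z ^+ l = 1 -> z != 1 ->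
  \sum_(k <- iota 1 l.-1) z ^+ k = -1.
Proof.
move=> l1 zl z1; apply/eqP; rewrite -addr_eq0 addrC.
have : (z - 1) * \sum_(k < l) z ^+ k = 0 by rewrite -subrX1 zl subrr.
move/eqP; rewrite mulf_eq0 subr_eq0 (negPf z1) /=.
case: l l1 zl => // l _ _; rewrite big_ord_recl expr0 /=.
congr (1 + _ == 0); have -> : iota 1 l = index_iota 1 l.+1 by rewrite /index_iota subn1.
by rewrite big_add1 big_mkord.
Qed.

(** The sum of all the characters of order dividing [l] is [l] on the nonzero [l]-th
    powers and 0 on the other nonzero elements. *)
Lemma free_indicator l x : prime l -> (l %| N)%N -> x != 0 ->
  (~~ (l %| dlog gam x)%N)%:R = (1 - l%:R^-1) * (1 - power_residue l x).
Proof.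
move=> pl lN x0; have l1 := prime_gt1 pl; have l0 := prime_gt0 pl.
have lR : (l%:R : algC) != 0 by rewrite pnatr_eq0 -lt0n.
have l1E : (l%:R : algC) = (l.-1)%:R + 1 by rewrite natr1 prednK.
have l1R : ((l.-1)%:R : algC) != 0 by rewrite pnatr_eq0; case: l l1 {pl lN l0 lR l1E} => [|[]].
pose z := w ^+ (N %/ l * dlog gam x).
have chz k : ch (k * (N %/ l)) x = z ^+ k.
  by rewrite /mchar (negPf x0) -!exprM; congr (_ ^+ _); lia.
have z1 : (z == 1) = (l %| dlog gam x)%N.
  have Nl : (0 < N %/ l)%N by rewrite divn_gt0 // dvdn_leq.
  by rewrite -(prim_order_dvd wp) -{1}(divnK lN) dvdn_pmul2l.
have zl : z ^+ l = 1.
  by rewrite -exprM mulnAC divnK // exprM wN expr1n.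
rewrite /power_residue; under eq_bigr do rewrite chz.
rewrite -z1; case: eqVneq => [->|zn1] /=.
  under eq_bigr do rewrite expr1n.
  by rewrite big_const_seq iter_addr_0 count_predT size_iota mulVf // subrr mulr0.
rewrite sum_iota_root // l1E; field.
by rewrite l1R -l1E lR.
Qed.

Definition corr s1 s2 : algC := \sum_(x : F) char_eval s1 x * char_eval s2 (phi x).
Definition corr1 a b : algC := \sum_(x : F) ch a x * ch b (phi x).

Lemma corr_expand s1 s2 :
  corr s1 s2 = \sum_(t1 <- s1) \sum_(t2 <- s2) t1.1 * t2.1 * corr1 t1.2 t2.2.
Proof.
rewrite /corr; under eq_bigr do rewrite /char_eval mulr_suml.
rewrite exchange_big /=; apply: eq_bigr => t1 _.
under eq_bigr do rewrite mulr_sumr.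
rewrite exchange_big /=; apply: eq_bigr => t2 _.
by rewrite /corr1 mulr_sumr; apply: eq_bigr => x _; ring.
Qed.

Lemma corr_catl s1 s2 s3 : corr (s1 ++ s2) s3 = corr s1 s3 + corr s2 s3.
Proof.
by rewrite /corr -big_split /=; apply: eq_bigr => x _; rewrite char_eval_cat mulrDl.
Qed.

Lemma corr_catr s1 s2 s3 : corr s1 (s2 ++ s3) = corr s1 s2 + corr s1 s3.
Proof.
by rewrite /corr -big_split /=; apply: eq_bigr => x _; rewrite char_eval_cat mulrDr.
Qed.

Variable B : algC.
Hypothesis corr1_bound : forall a b, ~~ ((N %| a)%N && (N %| b)%N) -> `|corr1 a b| <= B.

Lemma corr_bound s1 s2 : nontrivial s1 || nontrivial s2 ->
  `|corr s1 s2| <= char_norm s1 * char_norm s2 * B.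
Proof.
move=> h; rewrite corr_expand /char_norm !mulr_suml.
apply: le_trans (ler_norm_sum _ _ _) _.
rewrite big_seq [X in _ <= X]big_seq; apply: ler_sum => t1 h1.
rewrite mulr_sumr mulr_suml; apply: le_trans (ler_norm_sum _ _ _) _.
rewrite big_seq [X in _ <= X]big_seq; apply: ler_sum => t2 h2.
rewrite !normrM ler_wpM2l ?mulr_ge0 //; apply: corr1_bound; rewrite negb_and.
by case/orP: h => /allP h; [rewrite (h _ h1) | rewrite (h _ h2) orbT].
Qed.

Lemma corr_free L : all (leq 2) L -> nontrivial (free_rest L) ->
  `|corr (free_terms L) (free_terms L) - corr1 0 0| <= ((2 ^+ size L) ^+ 2 - 1) * B.
Proof.
move=> L2 nt.
have -> : corr (free_terms L) (free_terms L) - corr1 0 0 =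
    corr (free_rest L) [:: (1, 0%N)] + corr (free_terms L) (free_rest L).
  rewrite {2}/free_terms -cat1s corr_catr.
  rewrite {1}/free_terms -cat1s corr_catl.
  have -> : corr [:: (1, 0%N)] [:: (1, 0%N)] = corr1 0 0.
    by rewrite corr_expand !big_seq1 /= !mul1r.
  ring.
apply: le_trans (ler_normD _ _) _.
apply: le_trans (lerD (corr_bound _) (corr_bound _)) _; rewrite ?nt ?orbT //.
rewrite char_norm_cons /char_norm big_nil -!/(char_norm _) char_norm_rest // char_norm_free //.
by rewrite normr1 addr0 mulr1 -mulrDl le_eqVlt; apply/orP; left; apply/eqP; ring.
Qed.

Definition sieve_weight ps : algC := 1 - 2 * \sum_(p <- ps) (p%:R)^-1.

(** If [x] and [phi x] are nonzero, then up to the positive factor [th ^ 2] the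
    left-hand side is the indicator that both avoid the [l]-th powers for [l] in
    [L], times one minus the number of failures at the primes of [ps].  If one of
    them is zero, so is the left-hand side. *)
Lemma sieve_pointwise L ps x a r :
  a = char_eval (free_terms L) ->
  r = (fun p => char_eval (residue_terms p (free_terms L))) ->
  all prime (L ++ ps) -> all (fun l => l %| N)%N (L ++ ps) ->
  ~~ [&& x != 0, phi x != 0 & all (fun l => ~~ (l %| dlog gam x)%N && ~~ (l %| dlog gam
    (phi x))%N) (L ++ ps)] ->
  a x * a (phi x) - \sum_(p <- ps)
    ((p%:R^-1 * a x - (1 - p%:R^-1) * r p x) * a (phi x) +
     a x * (p%:R^-1 * a (phi x) - (1 - p%:R^-1) * r p (phi x))) <= 0.
Proof.
move=> aE rE pr dv bad.
have [x0|x0] := eqVneq x 0.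
  rewrite x0 aE rE char_eval0 mul0r sub0r oppr_le0 big1 // => p _.
  by rewrite !char_eval0; ring.
have [y0|y0] := eqVneq (phi x) 0.
  rewrite y0 aE rE char_eval0 mulr0 sub0r oppr_le0 big1 // => p _.
  by rewrite !char_eval0; ring.
rewrite x0 y0 /= in bad.
move: pr dv; rewrite !all_cat => /andP [prL prp] /andP [dvL dvp].
pose fr l z : algC := (~~ (l %| dlog gam z)%N)%:R.
have hr p z : p \in ps -> z != 0 -> p%:R^-1 * a z - (1 - p%:R^-1) * r p z = a z * (1 - fr p z).
  move=> pp z0; rewrite /fr free_indicator ?(allP prp) ?(allP dvp) //.
  by rewrite rE char_eval_residue // -aE; ring.
have -> : \sum_(p <- ps) ((p%:R^-1 * a x - (1 - p%:R^-1) * r p x) * a (phi x) +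
     a x * (p%:R^-1 * a (phi x) - (1 - p%:R^-1) * r p (phi x))) =
   a x * a (phi x) * \sum_(p <- ps) ((1 - fr p x) + (1 - fr p (phi x))).
  rewrite mulr_sumr; apply: eq_big_seq => p pp.
  by rewrite !hr //; ring.
rewrite -{1}[a x * a (phi x)]mulr1 -mulrBr.
pose th : algC := \prod_(l <- L) (1 - l%:R^-1).
have th0 : 0 < th.
  rewrite /th big_seq; apply: prodr_gt0 => l /(allP prL)/prime_gt1 l1.
  by rewrite subr_gt0 invf_lt1 ?ltr1n // ltr0n ltnW.
have tha z : z != 0 -> th * a z = (all (fun l => ~~ (l %| dlog gam z)%N) L)%:R.
  move=> z0; rewrite aE free_termsE // /th -big_split /=.
  elim: (L) prL dvL => [|l L' IH] /=; first by rewrite big_nil.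
  move=> /andP [pl pL'] /andP [lN LN']; rewrite big_cons IH // -free_indicator //.
  by case: (~~ _); rewrite ?mul1r ?mul0r.
rewrite -(pmulr_rle0 _ th0) -(pmulr_rle0 _ th0).
set S := 1 - _.
have -> : th * (th * (a x * a (phi x) * S)) = (th * a x) * (th * a (phi x)) * S by ring.
rewrite !tha //.
case hx: (all _ L); last by rewrite !mul0r.
case hy: (all _ L); last by rewrite mulr0 !mul0r.
rewrite !mul1r /S subr_le0.
have /allPn [p pps hp] : ~~ all (fun l => ~~ (l %| dlog gam x)%N && ~~ (l %| dlog gam (phi
  x))%N) ps.
  apply: contra bad; rewrite all_cat => ->; rewrite andbT.
  by apply/allP => l lL; rewrite (allP hx) // (allP hy).
rewrite (big_rem p) //= -[X in X <= _]addr0; apply: lerD.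
  rewrite /fr; move: hp; rewrite negb_and !negbK => /orP [|] ->; rewrite /= subr0.
    by rewrite lerDl subr_ge0; case: (~~ _); rewrite ?ler01.
  by rewrite lerDr subr_ge0; case: (~~ _); rewrite ?ler01.
apply: sumr_ge0 => l _; rewrite /fr addr_ge0 // subr_ge0.
  by case: (~~ _); rewrite ?ler01.
by case: (~~ _); rewrite ?ler01.
Qed.

(** Summing [sieve_pointwise] over [x] when there is no good [x] gives
    [delta * corr1 0 0 <= error].  The error consists of nontrivial pairs of
    characters of total coefficient [W^2 - 1], multiplied by [delta], and, for each
    [p] in [ps], of pairs of total coefficient [2 W^2], multiplied by [1 - 1/p];
    the numbers [2 (1 - 1/p)] add up to [2 s - 1 + delta]. *)
Theorem sieve_exists L ps (t0 : nat) :
  uniq (L ++ ps) -> all prime (L ++ ps) -> all (fun l => l %| N)%N (L ++ ps) ->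
  t0%:R <= corr1 0 0 -> 0 < sieve_weight ps ->
  ((2 * size ps)%:R - 1 + 2 * sieve_weight ps) * (2 ^+ size L) ^+ 2 * B <
     sieve_weight ps * (t0%:R + B) ->
  exists x, [/\ x != 0, phi x != 0 &
    all (fun l => ~~ (l %| dlog gam x)%N && ~~ (l %| dlog gam (phi x))%N) (L ++ ps)].
Proof.
move=> u pr dv ht d0 hlt; set dl := sieve_weight ps in d0 hlt.
case: (boolP [exists x, [&& x != 0, phi x != 0 &
    all (fun l => ~~ (l %| dlog gam x)%N && ~~ (l %| dlog gam (phi x))%N) (L ++ ps)]]).
  by case/existsP => x /and3P [h1 h2 h3]; exists x.
rewrite negb_exists => /forallP hbad; exfalso.
have pL : all prime L by move: pr; rewrite all_cat => /andP [].
have pp : all prime ps by move: pr; rewrite all_cat => /andP [].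
have dL : all (fun l => l %| N)%N L by move: dv; rewrite all_cat => /andP [].
have dp : all (fun l => l %| N)%N ps by move: dv; rewrite all_cat => /andP [].
have L2 : all (leq 2) L by apply: sub_all pL => l /prime_gt1.
have uL : uniq L by move: u; rewrite cat_uniq => /andP [].
pose tL := free_terms L; pose r p := residue_terms p tL.
pose W : algC := 2 ^+ size L.
pose c := corr tL tL.
pose G := c - \sum_(p <- ps) (2 * p%:R^-1 * c - (1 - p%:R^-1) * (corr (r p) tL + corr tL (r
  p))).
have G0 : G <= 0.
  have -> : G = \sum_(x : F) (char_eval tL x * char_eval tL (phi x) - \sum_(p <- ps)
    ((p%:R^-1 * char_eval tL x - (1 - p%:R^-1) * char_eval (r p) x) * char_eval tL (phi x) +
     char_eval tL x * (p%:R^-1 * char_eval tL (phi x) - (1 - p%:R^-1) * char_eval (r p)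
       (phi x)))).
    rewrite sumrB exchange_big /= /G; congr (_ - _); apply: eq_bigr => p _.
    rewrite /c /corr -big_split /= !mulr_sumr -sumrB; apply: eq_bigr => x _; ring.
  by apply: sumr_le0 => x _; exact: (sieve_pointwise (erefl _) (erefl _) pr dv (hbad x)).
have hc : `|c - corr1 0 0| <= (W ^+ 2 - 1) * B.
  by apply: corr_free => //; apply: nontrivial_rest.
have hp p : p \in ps -> `|corr (r p) tL + corr tL (r p)| <= 2 * (W ^+ 2 * B).
  move=> pps; have ppr := allP pp _ pps.
  have nt : nontrivial (r p).
    apply: nontrivial_residue => //; last exact: (allP dp).
    apply/negP => pL'; move: u; rewrite cat_uniq => /and3P [_ /hasPn/(_ _ pps)].
    by rewrite /= pL'.
  have nr : char_norm (r p) = W by rewrite char_norm_residue ?prime_gt1 // char_norm_free.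
  have nL : char_norm tL = W by rewrite char_norm_free.
  apply: le_trans (ler_normD _ _) _.
  apply: le_trans (lerD (corr_bound _) (corr_bound _)) _; rewrite ?nt ?orbT //.
  by rewrite nr nL le_eqVlt; apply/orP; left; apply/eqP; ring.
have th p : p \in ps -> 0 <= 1 - (p%:R : algC)^-1.
  move/(allP pp)/prime_gt1 => p1; rewrite subr_ge0 invf_le1 ?ler1n ?ltr0n ltnW //.
have GE : G = dl * c + \sum_(p <- ps) (1 - p%:R^-1) * (corr (r p) tL + corr tL (r p)).
  rewrite /G sumrB -mulr_suml -mulr_sumr /dl /sieve_weight; ring.
have sE : \sum_(p <- ps) (1 - (p%:R : algC)^-1) * (2 * (W ^+ 2 * B)) =
    ((2 * size ps)%:R - 1 + dl) * W ^+ 2 * B.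
  rewrite -mulr_suml sumrB big_const_seq count_predT iter_addr_0 /dl /sieve_weight natrM; ring.
have h1 : `|dl * corr1 0 0 - G| <= dl * ((W ^+ 2 - 1) * B) + ((2 * size ps)%:R - 1 + dl) *
  W ^+ 2 * B.
  have -> : dl * corr1 0 0 - G = - (dl * (c - corr1 0 0) +
      \sum_(p <- ps) (1 - p%:R^-1) * (corr (r p) tL + corr tL (r p))).
    by rewrite GE; ring.
  rewrite normrN; apply: le_trans (ler_normD _ _) _; apply: lerD.
    by rewrite normrM (ger0_norm (ltW d0)) ler_wpM2l // ltW.
  apply: le_trans (ler_norm_sum _ _ _) _; rewrite -sE.
  rewrite big_seq [X in _ <= X]big_seq; apply: ler_sum => p pps.
  by rewrite normrM (ger0_norm (th p pps)) ler_wpM2l ?th // hp.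
have h2 : dl * t0%:R <= `|dl * corr1 0 0 - G|.
  apply: le_trans (_ : dl * corr1 0 0 - G <= _).
    apply: le_trans (_ : dl * corr1 0 0 <= _); first by rewrite ler_wpM2l // ltW.
    by rewrite lerDl oppr_ge0.
  apply: real_ler_norm; rewrite realB ?(ler0_real G0) //.
  rewrite realM ?(gtr0_real d0) //.
  by rewrite (ger_real ht) realn.
suff h : dl * (t0%:R + B) <= ((2 * size ps)%:R - 1 + 2 * dl) * W ^+ 2 * B.
  by have := lt_le_trans hlt h; rewrite ltxx.
rewrite mulrDr -lerBrDr; apply: le_trans (le_trans h2 h1) _.
by rewrite le_eqVlt; apply/orP; left; apply/eqP; ring.
Qed.
End Sieve.

(** * Rational sufficient conditions *)

(** The main term is at least [q - 1 - n], the excluded points being 0 and the zeros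
    and poles of [f]; this loss is absorbed by one unit [n sqrt q] of the error
    term. *)
Theorem sieve_criterion (F : finFieldType) (n : nat) (f : ratfun F) (L ps : seq nat) :
  (0 < n)%N -> (4 < #|F|)%N -> in_R n f ->
  perm_eq (L ++ ps) (primes #|F|.-1) ->
  0 < sieve_weight ps ->
  ((2 * size ps)%:R - 1 + 2 * sieve_weight ps) * (2 ^+ size L) ^+ 2 * n%:R <=
     sieve_weight ps * sqrtC #|F|%:R ->
  exists a, primitive_pair f a.
Proof.
move=> n0 q4 [fne [f1 [f2 [flow fn _]]]] perm d0 hd.
have N0 : (0 < #|F|.-1)%N by lia.
have [gam gamP] := finField_prim_root F.
have [w wp] := C_prim_root_exists N0.
have pm l : (l \in L ++ ps) = prime l && (l %| #|F|.-1)%N.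
  by rewrite (perm_mem perm) mem_primes N0.
pose r : algC := sqrtC #|F|%:R.
have rr : r * r = #|F|%:R by rewrite -expr2 sqrtCK.
have r2 : 2 < r.
  rewrite -(@ltr_pXn2r _ 2) ?nnegrE ?ler0n ?sqrtC_ge0 ?ler0n // sqrtCK.
  by rewrite -natrX ltr_nat.
have r0 : 0 < r by apply: lt_trans r2; rewrite ltr0n.
have hlt : ((2 * size ps)%:R - 1 + 2 * sieve_weight ps) * (2 ^+ size L) ^+ 2 * (n%:R * r) <
     sieve_weight ps * ((#|F| - 1 - n)%:R + n%:R * r).
  apply: (@le_lt_trans _ _ (sieve_weight ps * #|F|%:R)).
    by rewrite mulrA -rr [X in _ <= X]mulrA ler_wpM2r // ltW.
  rewrite ltr_pM2l //.
  apply: (@le_lt_trans _ _ ((#|F| - 1 - n)%:R + (n.+1)%:R)).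
    by rewrite -natrD ler_nat; lia.
  rewrite ltrD2l; apply: (@le_lt_trans _ _ (n%:R * 2)).
    by rewrite -natrM ler_nat; lia.
  by rewrite ltr_pM2l ?ltr0n.
have dvall : all (fun l => l %| #|F|.-1)%N (L ++ ps) by apply/allP => l; rewrite pm => /andP [].
have prall : all prime (L ++ ps) by apply/allP => l; rewrite pm => /andP [].
have uall : uniq (L ++ ps) by rewrite (perm_uniq perm) primes_uniq.
have hb a b : ~~ ((#|F|.-1 %| a)%N && (#|F|.-1 %| b)%N) ->
    `|corr1 gam w (ratval f1 f2) a b| <= n%:R * r.
  by move=> h; have := pair_sum_bound gamP wp flow fne h; rewrite fn.
have h0 : (#|F| - 1 - n)%:R <= corr1 gam w (ratval f1 f2) 0 0.
  by have := pair_sum00 gamP wp flow; rewrite fn.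
have [x [x0 y0 /allP hx]] := sieve_exists gamP wp hb uall prall dvall h0 d0 hlt.
have prim z : z != 0 -> (forall l, l \in L ++ ps -> ~~ (l %| dlog gam z)%N) ->
  primitive_element z.
  move=> z0 hz; apply: prim_root_primitive_element.
  have := exp_prim_root gamP (dlog gam z); rewrite dlogP //.
  suff -> : gcdn (dlog gam z) #|F|.-1 = 1%N by rewrite divn1.
  apply/eqP; apply: contraT => g1.
  have g0 : (0 < gcdn (dlog gam z) #|F|.-1)%N by rewrite gcdn_gt0 N0 orbT.
  have g2 : (1 < gcdn (dlog gam z) #|F|.-1)%N by rewrite ltn_neqAle eq_sym g1.
  have pd := pdiv_dvd (gcdn (dlog gam z) #|F|.-1).
  have := hz (pdiv (gcdn (dlog gam z) #|F|.-1)).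
  rewrite pm pdiv_prime // (dvdn_trans pd (dvdn_gcdr _ _)) (dvdn_trans pd (dvdn_gcdl _ _)).
  by move/(_ isT).
exists x, f1, f2; split=> //.
- by apply: contraNneq y0 => h; rewrite /ratval h invr0 mulr0.
- by apply: prim => // l /hx /andP [].
- by apply: prim => // l /hx /andP [].
Qed.

Definition sieve_weight_rat (ps : seq nat) : rat := 1 - 2 * \sum_(p <- ps) (p%:R)^-1.

Lemma sieve_weight_ratr ps : sieve_weight ps = ratr (sieve_weight_rat ps).
Proof.
rewrite /sieve_weight /sieve_weight_rat rmorphB rmorph1 rmorphM /= ratr_nat rmorph_sum /=.
by congr (1 - _ * _); apply: eq_bigr => p _; rewrite fmorphV /= ratr_nat.
Qed.

Lemma sieve_criterion_rat (F : finFieldType) (n : nat) (f : ratfun F) (L ps : seq nat) (k :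
  rat) :
  (0 < n)%N -> (4 < #|F|)%N -> in_R n f ->
  perm_eq (L ++ ps) (primes #|F|.-1) ->
  0 < sieve_weight_rat ps -> 0 <= k ->
  (2 * size ps)%:R - 1 + 2 * sieve_weight_rat ps <= k * sieve_weight_rat ps ->
  (n%:R * (2 ^+ size L) ^+ 2 * k) ^+ 2 <= #|F|%:R ->
  exists a, primitive_pair f a.
Proof.
move=> n0 q4 fR perm d0 k0 hk hq.
apply: (sieve_criterion n0 q4 fR perm); rewrite sieve_weight_ratr; first by rewrite ltr0q.
have hr : ratr (n%:R * (2 ^+ size L) ^+ 2 * k) <= sqrtC (#|F|%:R : algC).
  rewrite -(@ler_pXn2r _ 2) ?nnegrE ?sqrtC_ge0 ?ler0n ?ler0q //.
    by rewrite sqrtCK -rmorphXn /= -[X in _ <= X]ratr_nat ler_rat.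
  by rewrite !mulr_ge0 ?ler0n ?exprn_ge0.
apply: (@le_trans _ _ (ratr (sieve_weight_rat ps * (n%:R * (2 ^+ size L) ^+ 2 * k)))).
  move: (2 * size ps)%N (size L) (sieve_weight_rat ps) hk => s l d hk.
  have -> : (s%:R - 1 + 2 * ratr d) * (2 ^+ l) ^+ 2 * n%:R =
      ratr ((s%:R - 1 + 2 * d) * (2 ^+ l) ^+ 2 * n%:R) :> algC.
    have e2 : ratr (2 ^+ l) = 2 ^+ l :> algC by rewrite rmorphXn /= ratr_nat.
    by rewrite 2!rmorphM /= rmorphXn /= e2 rmorphD rmorphB rmorph1 /= rmorphM /= !ratr_nat.
  rewrite ler_rat -mulrA.
  have -> : d * (n%:R * (2 ^+ l) ^+ 2 * k) = k * d * ((2 ^+ l) ^+ 2 * n%:R) by ring.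
  by rewrite ler_wpM2r // mulr_ge0 ?ler0n // !exprn_ge0.
by rewrite rmorphM /= ler_wpM2l // ler0q ltW.
Qed.

Lemma plain_criterion (F : finFieldType) (n : nat) (f : ratfun F) :
  (0 < n)%N -> (4 < #|F|)%N -> in_R n f ->
  ((n%:R : rat) * (2 ^+ size (primes #|F|.-1)) ^+ 2) ^+ 2 <= #|F|%:R ->
  exists a, primitive_pair f a.
Proof.
move=> n0 q4 fR hq; have w1 : sieve_weight_rat [::] = 1.
  by rewrite /sieve_weight_rat big_nil mulr0 subr0.
apply: (@sieve_criterion_rat F n f (primes #|F|.-1) [::] 1) => //; rewrite ?w1 ?cats0 //.
by rewrite mulr1.
Qed.

Definition small_primes : seq nat :=
  [:: 2; 3; 5; 7; 11; 13; 17; 19; 23; 29; 31; 37; 41; 43; 47; 53; 59; 61; 67]%N.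
Local Notation sp i := (nth 0%N small_primes i).

(** There is no prime strictly between consecutive entries of [small_primes]. *)
Lemma nth_sorted_primes ps i : sorted ltn ps -> all prime ps ->
  (i < size ps)%N -> (i < 19)%N -> (sp i <= nth 0%N ps i)%N.
Proof.
move=> srt pr; have gap : all (fun i => all (fun k => ~~ prime k)
    (iota (sp i).+1 (sp i.+1 - (sp i).+1))) (iota 0 18) by vm_compute.
elim: i => [|i IH] ip i19.
  by apply: prime_gt1; apply: (allP pr); apply: mem_nth.
have := IH (ltnW ip) (ltnW i19).
have lt := sorted_ltn_nth ltn_trans 0%N srt i i.+1 (ltnW ip) ip (ltnSn i).
move=> h; rewrite leqNgt; apply/negP => h2.
have /allP/(_ i) := gap; rewrite mem_iota /= add0n => /(_ i19) /allP /(_ (nth 0%N ps i.+1)).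
rewrite mem_iota (leq_ltn_trans h lt) subnKC; last by apply: ltnW; apply: leq_ltn_trans h2;
  apply: leq_ltn_trans lt.
by rewrite h2 => /(_ isT) /negP; apply; apply: (allP pr); apply: mem_nth.
Qed.

Lemma prod_primes_le m : (0 < m)%N -> (\prod_(p <- primes m) p <= m)%N.
Proof.
move=> m0; rewrite {2}(prod_prime_decomp m0) /primes big_map big_seq [leqRHS]big_seq.
apply: leq_prod => [[p e]] /mem_prime_decomp [pp e0 _] /=.
by rewrite -{1}[p]expn1 leq_exp2l // prime_gt1.
Qed.

Lemma primorial_le m k : (0 < m)%N -> (k <= size (primes m))%N -> (k <= 19)%N ->
  (\prod_(0 <= i < k) sp i <= m)%N.
Proof.
move=> m0 km k19; apply: leq_trans (prod_primes_le m0).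
have pr : all prime (primes m) by apply/allP => p; rewrite mem_primes => /andP [].
rewrite [leqRHS](big_nth 0%N) [leqRHS](big_cat_nat (n := k)) //=.
rewrite -[X in (X <= _)%N]muln1; apply: leq_mul.
  rewrite big_nat [leqRHS]big_nat; apply: leq_prod => i /= ik.
  apply: nth_sorted_primes => //; [exact: sorted_primes | exact: leq_trans km | exact:
    leq_trans k19].
rewrite big_nat; apply: prodn_cond_gt0 => i /andP [_ ip].
by apply: prime_gt0; apply: (allP pr); apply: mem_nth.
Qed.

Lemma sum_inv_primes_le m t u : (t <= size (primes m))%N -> (size (primes m) <= t + u)%N ->
  (t + u <= 19)%N ->
  \sum_(p <- drop t (primes m)) (p%:R : rat)^-1 <= \sum_(t <= i < t + u) (sp i)%:R^-1.
Proof.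
move=> tm value_char tu.
have pr : all prime (primes m) by apply/allP => p; rewrite mem_primes => /andP [].
have -> : \sum_(t <= i < t + u) ((sp i)%:R : rat)^-1 = \sum_(0 <= i < u) (sp (i + t))%:R^-1.
  by rewrite -{1}[t]add0n big_addn addKn.
rewrite (big_nth 0%N) size_drop.
rewrite [X in _ <= X](big_cat_nat (n := size (primes m) - t)) //=; last by rewrite leq_subLR.
rewrite -[X in X <= _]addr0; apply: lerD; last first.
  by apply: sumr_ge0 => i _; rewrite invr_ge0 ler0n.
rewrite big_nat [X in _ <= X]big_nat; apply: ler_sum => i /= im.
rewrite nth_drop addnC.
have it : (i + t < size (primes m))%N by move: im; rewrite ltn_subRL addnC.
have ip : prime (nth 0%N (primes m) (i + t)) by apply: (allP pr); apply: mem_nth.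
have i19 : (i + t < 19)%N by lia.
have h := nth_sorted_primes (sorted_primes m) pr it i19.
have sp0 : (0 < sp (i + t))%N.
  have : all (fun i => 0 < sp i)%N (iota 0 19) by [].
  by move/allP; apply; rewrite mem_iota.
by rewrite lef_pV2 ?posrE ?ltr0n ?(leq_trans sp0 h) // ler_nat.
Qed.

(** * The explicit constants *)


Lemma primorial_le_rat m k : (0 < m)%N -> (k <= size (primes m))%N -> (k <= 19)%N ->
  \prod_(0 <= i < k) ((sp i)%:R : rat) <= m%:R.
Proof. by move=> m0 km k19; rewrite -natr_prod ler_nat; exact: primorial_le. Qed.

(** Among integers with a bounded number of prime factors the worst case for the
    sieved primes is that of consecutive primes following the [t] smallest ones. *)
Lemma sieve_case (F : finFieldType) n (f : ratfun F) t u (k : rat) :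
  (0 < n)%N -> (4 < #|F|)%N -> in_R n f ->
  (t <= size (primes #|F|.-1) <= t + u)%N -> (t + u <= 19)%N ->
  0 < 1 - 2 * \sum_(t <= i < t + u) ((sp i)%:R : rat)^-1 -> 2 <= k ->
  2 * u%:R - 1 <= (k - 2) * (1 - 2 * \sum_(t <= i < t + u) ((sp i)%:R : rat)^-1) ->
  (n%:R * (2 ^+ t) ^+ 2 * k) ^+ 2 <= #|F|%:R ->
  exists a, primitive_pair f a.
Proof.
move=> n0 q4 fR /andP [tw wtu] tu; set d0 : rat := 1 - _ => d00 k2 hk hq.
have hd : d0 <= sieve_weight_rat (drop t (primes #|F|.-1)).
  by rewrite /d0 /sieve_weight_rat lerD2l lerN2 ler_wpM2l //; exact: sum_inv_primes_le.
set d := sieve_weight_rat _ in hd.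
apply: (@sieve_criterion_rat F n f (take t (primes #|F|.-1)) (drop t (primes #|F|.-1)) k) => //.
- by rewrite cat_take_drop.
- exact: lt_le_trans hd.
- exact: le_trans k2.
- rewrite -/d size_drop natrM.
  have hs : ((size (primes #|F|.-1) - t)%:R : rat) <= u%:R by rewrite ler_nat leq_subLR.
  have h1 : (k - 2) * d0 <= (k - 2) * d by rewrite ler_wpM2l // subr_ge0.
  move: hs h1 hk; rewrite !mulrBl; lra.
by rewrite size_take_min (minn_idPl tw).
Qed.

Definition weight_const : rat := \prod_(0 <= i < 18) (64 / (sp i)%:R).

(** The ratio [64 / p] is at most 1 for the primes above 64 and at least 1 for the
    18 primes below, so including all of the latter can only increase the
    product. *)
Lemma pow64_le m : (0 < m)%N ->
  (64 : rat) ^+ size (primes m) <= m%:R * weight_const.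
Proof.
move=> m0; have pr : all prime (primes m) by apply/allP => p; rewrite mem_primes => /andP [].
pose g (p : nat) : rat := 64 / p%:R.
have g0 p : p \in primes m -> 0 < g p.
  by move/(allP pr)/prime_gt0 => p0; rewrite divr_gt0 // ltr0n.
have P0 : 0 < \prod_(p <- primes m) (p%:R : rat).
  by rewrite big_seq; apply: prodr_gt0 => p /(allP pr)/prime_gt0; rewrite ltr0n.
have -> : (64 : rat) ^+ size (primes m) = \prod_(p <- primes m) p%:R * \prod_(p <- primes
  m) g p.
  rewrite -big_split /= big_seq (eq_bigr (fun=> 64)) => [|p /(allP pr)/prime_gt0 p0].
    by rewrite -big_seq big_const_seq count_predT iter_mulr_1.
  by rewrite /g mulrC divfK // pnatr_eq0 -lt0n.
apply: ler_pM; first exact: ltW.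
- by rewrite big_seq; apply: prodr_ge0 => p /g0 /ltW.
- by rewrite -natr_prod ler_nat; exact: prod_primes_le.
pose S := take 18 small_primes.
have -> : weight_const = \prod_(p <- S) g p.
  by rewrite (big_nth 0%N) /weight_const; apply: eq_big_nat => i /andP [_ i18];
    rewrite nth_take.
rewrite (bigID (fun p => p < 64)%N) /= [X in _ <= X](bigID (fun p => p \in primes m)) /=.
have hS : all (fun p => (p < 64)%N && (0 < p)%N) S by [].
have hS2 : all (fun p => prime p ==> (p \in S)) (iota 0 64) by vm_compute.
apply: (@le_trans _ _ (\prod_(p <- primes m | (p < 64)%N) g p)).
  rewrite -[X in _ <= X]mulr1; apply: ler_pM => //.
  - by rewrite big_seq_cond; apply: prodr_ge0 => p /andP [/g0 /ltW].
  - by rewrite big_seq_cond; apply: prodr_ge0 => p /andP [/g0 /ltW].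
  rewrite big_seq_cond; apply: prodr_ile1 => p /andP [pm].
  rewrite -leqNgt => p64; apply/andP; split; first exact: ltW (g0 _ pm).
  have p0 : (0 : rat) < p%:R by rewrite ltr0n; exact: leq_trans p64.
  have p64R : (64%:R : rat) <= p%:R by rewrite ler_nat.
  by rewrite /g (ler_pdivrMr _ _ p0) mul1r; exact: p64R.
have -> : \prod_(p <- primes m | (p < 64)%N) g p = \prod_(p <- S | p \in primes m) g p.
  rewrite -big_filter -[RHS]big_filter; apply: perm_big; apply: uniq_perm.
  - by rewrite filter_uniq ?primes_uniq.
  - by rewrite filter_uniq.
  move=> p; rewrite !mem_filter andbC; case pm: (p \in primes m) => //=.
  apply/idP/idP => [p64|pS]; last by have /andP [] := allP hS _ pS.
  have := allP hS2 p; rewrite mem_iota p64 => /(_ isT) /implyP; apply; exact: (allP pr).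
rewrite -[X in X <= _]mulr1; apply: ler_pM => //.
  by rewrite big_seq_cond; apply: prodr_ge0 => p /andP [_ /g0 /ltW].
rewrite big_seq_cond; elim/big_rec: _ => [|p x /andP [pS _] x1]; first exact: lexx.
apply: le_trans (x1) _; apply: ler_peMl; first exact: le_trans ler01 x1.
have /andP [p64 p0] := allP hS _ pS.
have p0R : (0 : rat) < p%:R by rewrite ltr0n.
have p64R : (p%:R : rat) <= 64%:R by rewrite ler_nat ltnW.
by rewrite /g (ler_pdivlMr _ _ p0R) mul1r; exact: p64R.
Qed.

(** The number [2.7669 * 10^9] lies between the product and the square root of
    [7.65713 * 10^18]. *)
Lemma weight_product_le (K : realFieldType) :
  64 / 2 * (64 / 3 * (64 / 5 * (64 / 7 * (64 / 11 * (64 / 13 * (64 / 17 * (64 / 19 *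
  (64 / 23 * (64 / 29 * (64 / 31 * (64 / 37 * (64 / 41 * (64 / 43 * (64 / 47 *
  (64 / 53 * (64 / 59 * (64 / 61 * 1))))))))))))))))) <= (27 * 1000 + 669) * 10 ^+ 5 :> K.
Proof. lra. Qed.

Lemma sqr_const_le (K : realFieldType) (x : K) :
  0 <= x -> x <= (27 * 1000 + 669) * 10 ^+ 5 -> x ^+ 2 <= (765 * 1000 + 713) * 10 ^+ 13.
Proof.
move=> x0 xA; have h := ler_pM x0 x0 xA xA; rewrite expr2.
apply: le_trans h _; lra.
Qed.

Lemma four_lt_general (K : realFieldType) (y q : K) :
  1 <= y -> y * ((765 * 1000 + 713) * 10 ^+ 13) < q -> 4 < q.
Proof. lra. Qed.

(** With [s = 2^om] this compares the sixth powers of [n W^2] and [sqrt q]: the sixth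
    power of [W^2] is bounded by [q^2 c]. *)
Lemma sixth_power_le (K : realFieldType) (n s q v c : K) :
  0 <= n -> 0 < q -> 0 <= s -> 0 <= v -> s ^+ 6 <= q * v -> v ^+ 2 <= c ->
  n ^+ 6 * c <= q -> (n * s ^+ 2) ^+ 2 <= q.
Proof.
move=> n0 q0 s0 v0 h1 h2 h3; have q0' := ltW q0.
rewrite -(@ler_pXn2r _ 3) ?nnegrE ?exprn_ge0 ?mulr_ge0 ?exprn_ge0 //.
have -> : ((n * s ^+ 2) ^+ 2) ^+ 3 = n ^+ 6 * (s ^+ 6) ^+ 2 by ring.
have h4 : (s ^+ 6) ^+ 2 <= q ^+ 2 * c.
  apply: le_trans (_ : (q * v) ^+ 2 <= _).
    by rewrite ler_pXn2r ?nnegrE ?exprn_ge0 ?mulr_ge0.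
  by rewrite exprMn ler_wpM2l ?exprn_ge0.
apply: le_trans (_ : n ^+ 6 * (q ^+ 2 * c) <= _).
  by rewrite ler_wpM2l ?exprn_ge0.
by rewrite mulrCA [q ^+ 3]exprSr ler_wpM2l ?exprn_ge0.
Qed.

Lemma weight_const_sqr : weight_const ^+ 2 <= (765 * 1000 + 713) * 10 ^+ 13.
Proof.
have h : weight_const <= (27 * 1000 + 669) * 10 ^+ 5.
  have -> : weight_const = \prod_(i <- [:: 0; 1; 2; 3; 4; 5; 6; 7; 8; 9; 10; 11; 12;
      13; 14; 15; 16; 17]%N) (64 / (sp i)%:R) by [].
  rewrite !big_cons big_nil; cbv [nth small_primes]; exact: weight_product_le.
have w0 : 0 <= weight_const by apply: prodr_ge0 => i _; rewrite divr_ge0 ?ler0n.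
exact: sqr_const_le w0 h.
Qed.

Lemma large_case (F : finFieldType) n (f : ratfun F) :
  (1 < n)%N -> in_R n f -> (n%:R : rat) ^+ 6 * ((765 * 1000 + 713) * 10 ^+ 13) < #|F|%:R ->
  exists a, primitive_pair f a.
Proof.
move=> n1 fR hq; have n0 := ltnW n1; have F1 := finNzRing_gt1 F.
have m0 : (0 < #|F|.-1)%N by rewrite -subn1 subn_gt0.
have n6 : 1 <= (n%:R : rat) ^+ 6 by rewrite exprn_ege1 // ler1n.
have q4 : (4 < #|F|)%N.
  by rewrite -(ltr_nat rat); exact: four_lt_general n6 hq.
apply: (plain_criterion n0 q4 fR).
set om := size _; set q : rat := #|F|%:R.
have q0 : 0 < q by rewrite ltr0n ltnW.
have hw : (64 : rat) ^+ om <= q * weight_const.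
  apply: le_trans (pow64_le m0) _; apply: ler_wpM2r; last by rewrite ler_nat leq_pred.
  by rewrite /weight_const; apply: prodr_ge0 => i _; rewrite divr_ge0 ?ler0n.
apply: (sixth_power_le _ q0 _ _ _ weight_const_sqr (ltW hq)); rewrite ?ler0n ?exprn_ge0 //.
  by apply: prodr_ge0 => i _; rewrite divr_ge0 ?ler0n.
by rewrite -exprM mulnC exprM.
Qed.

Section NumericFacts.
Variable K : realFieldType.
Implicit Types n q : K.

Lemma two_le_kappa : 2 <= 27 + 3901 / 10 ^+ 4 :> K. Proof. lra. Qed.
Lemma two_le_61 : 2 <= 61 :> K. Proof. lra. Qed.
Lemma two_le_91 : 2 <= 91 :> K. Proof. lra. Qed.

(** The value [27.3901] just exceeds [(2 * 5 - 1) / d + 2]; replacing it by [27.4]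
    would already miss the stated constants for [n = 3, 4, 5]. *)
Lemma weight_4_5 (d : K) : d = 1 - 2 * \sum_(4 <= i < 4 + 5) ((sp i)%:R : K)^-1 ->
  0 < d /\ 2 * 5%:R - 1 <= (27 + 3901 / 10 ^+ 4 - 2) * d.
Proof.
have -> : index_iota 4 (4 + 5) = [:: 4; 5; 6; 7; 8]%N by [].
by rewrite !big_cons big_nil; cbv [nth small_primes] => ->; split; lra.
Qed.

Lemma weight_4_7 (d : K) : d = 1 - 2 * \sum_(4 <= i < 4 + 7) ((sp i)%:R : K)^-1 ->
  0 < d /\ 2 * 7%:R - 1 <= (61 - 2) * d.
Proof.
have -> : index_iota 4 (4 + 7) = [:: 4; 5; 6; 7; 8; 9; 10]%N by [].
by rewrite !big_cons big_nil; cbv [nth small_primes] => ->; split; lra.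
Qed.

Lemma weight_6_12 (d : K) : d = 1 - 2 * \sum_(6 <= i < 6 + 12) ((sp i)%:R : K)^-1 ->
  0 < d /\ 2 * 12%:R - 1 <= (91 - 2) * d.
Proof.
have -> : index_iota 6 (6 + 12) = [:: 6; 7; 8; 9; 10; 11; 12; 13; 14; 15; 16; 17]%N by [].
by rewrite !big_cons big_nil; cbv [nth small_primes] => ->; split; lra.
Qed.

Lemma sqr_le_sqr (a b : K) : 0 <= a -> a <= b -> a ^+ 2 <= b ^+ 2.
Proof. by move=> a0 ab; rewrite !expr2 ler_pM. Qed.

Lemma plain_small n q (s : K) : 0 <= n -> 0 <= s -> s <= 64 ->
  (n * (2 ^+ 4) ^+ 2 * (27 + 3901 / 10 ^+ 4)) ^+ 2 <= q -> (n * s ^+ 2) ^+ 2 <= q.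
Proof.
move=> n0 s0 s64; apply: le_trans; apply: sqr_le_sqr; first by rewrite mulr_ge0 ?exprn_ge0.
rewrite -mulrA; apply: ler_wpM2l => //.
have := sqr_le_sqr s0 s64; lra.
Qed.

Lemma pow2_le64 m : (m <= 6)%N -> (2 : K) ^+ m <= 64.
Proof.
move=> m6; apply: (@le_trans _ _ (2 ^+ 6)); last by lra.
by rewrite ler_weXn2l // ler1n.
Qed.

Lemma four_lt_sqr n q : 1 <= n -> (n * (2 ^+ 4) ^+ 2 * (27 + 3901 / 10 ^+ 4)) ^+ 2 <= q ->
  4 < q.
Proof.
move=> n1; apply: lt_le_trans.
apply: lt_le_trans (sqr_le_sqr (a := 3) _ _); lra.
Qed.

Lemma sieve_4_7 n q :
  \prod_(0 <= i < 10) ((sp i)%:R : K) <= q ->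
  0 <= n -> n <= 5 -> (n * (2 ^+ 4) ^+ 2 * 61) ^+ 2 <= q.
Proof.
have -> : index_iota 0 10 = [:: 0; 1; 2; 3; 4; 5; 6; 7; 8; 9]%N by [].
rewrite !big_cons big_nil; cbv [nth small_primes] => hq n0 n5; apply: le_trans hq.
apply: le_trans (sqr_le_sqr (b := 5 * (2 ^+ 4) ^+ 2 * 61) _ _) _; lra.
Qed.

Lemma sieve_6_12 n q :
  \prod_(0 <= i < 12) ((sp i)%:R : K) <= q ->
  0 <= n -> n <= 5 -> (n * (2 ^+ 6) ^+ 2 * 91) ^+ 2 <= q.
Proof.
have -> : index_iota 0 12 = [:: 0; 1; 2; 3; 4; 5; 6; 7; 8; 9; 10; 11]%N by [].
rewrite !big_cons big_nil; cbv [nth small_primes] => hq n0 n5; apply: le_trans hq.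
apply: le_trans (sqr_le_sqr (b := 5 * (2 ^+ 6) ^+ 2 * 91) _ _) _; lra.
Qed.

Lemma many_primes n q :
  \prod_(0 <= i < 19) ((sp i)%:R : K) <= q ->
  0 <= n -> n <= 5 -> n ^+ 6 * ((765 * 1000 + 713) * 10 ^+ 13) < q.
Proof.
have -> : index_iota 0 19 = [:: 0; 1; 2; 3; 4; 5; 6; 7; 8; 9; 10; 11; 12; 13; 14; 15; 16;
  17; 18]%N by [].
rewrite !big_cons big_nil; cbv [nth small_primes] => hq n0 n5; apply: lt_le_trans hq.
have h : n ^+ 6 <= 5 ^+ 6 by rewrite ler_pXn2r ?nnegrE.
lra.
Qed.

End NumericFacts.

(** The number of prime factors of [q - 1] decides how many primes are sieved; from
    10 prime factors on, the lower bound on [q] comes from the product of the first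
    10, 12 or 19 primes. *)
Lemma small_degree_case (F : finFieldType) n (f : ratfun F) :
  (1 < n <= 5)%N -> in_R n f ->
  (n%:R * (2 ^+ 4) ^+ 2 * (27 + 3901 / 10 ^+ 4)) ^+ 2 <= (#|F|%:R : rat) ->
  exists a, primitive_pair f a.
Proof.
move=> /andP [n1 n5] fR hq; have n0 := ltnW n1; have F1 := finNzRing_gt1 F.
have m0 : (0 < #|F|.-1)%N by rewrite -subn1 subn_gt0.
have nR0 : 0 <= (n%:R : rat) by rewrite ler0n.
have nR5 : (n%:R : rat) <= 5%:R by rewrite ler_nat.
have qle x : x <= (#|F|.-1)%:R -> x <= (#|F|%:R : rat).
  by move/le_trans; apply; rewrite ler_nat leq_pred.
have q4 : (4 < #|F|)%N.
  by rewrite -(ltr_nat rat); apply: (four_lt_sqr _ hq); rewrite ler1n.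
set om := size (primes #|F|.-1).
have [om6|om6] := leqP om 6.
  have s0 : 0 <= (2 : rat) ^+ om by exact: exprn_ge0.
  exact: (plain_criterion n0 q4 fR (plain_small nR0 s0 (pow2_le64 rat om6) hq)).
have om4 : (4 <= om)%N by exact: leq_trans om6.
have [om9|om9] := leqP om 9.
  have [d0 hd] := weight_4_5 (erefl (1 - 2 * \sum_(4 <= i < 4 + 5) ((sp i)%:R : rat)^-1)).
  have hom : (4 <= om <= 4 + 5)%N by apply/andP; split; [exact: om4 | exact: om9].
  exact: (sieve_case n0 q4 fR hom isT d0 (two_le_kappa rat) hd hq).
have qP k : (k <= om)%N -> (k <= 19)%N -> \prod_(0 <= i < k) ((sp i)%:R : rat) <= #|F|%:R.
  by move=> h1 h2; apply: qle; exact: primorial_le_rat.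
have [om11|om11] := leqP om 11.
  have [d0 hd] := weight_4_7 (erefl (1 - 2 * \sum_(4 <= i < 4 + 7) ((sp i)%:R : rat)^-1)).
  have hom : (4 <= om <= 4 + 7)%N by apply/andP; split; [exact: om4 | exact: om11].
  have hQ := sieve_4_7 (qP 10%N om9 isT) nR0 nR5.
  exact: (sieve_case n0 q4 fR hom isT d0 (two_le_61 rat) hd hQ).
have om12 : (12 <= om)%N by exact: om11.
have [om18|om18] := leqP om 18.
  have [d0 hd] := weight_6_12 (erefl (1 - 2 * \sum_(6 <= i < 6 + 12) ((sp i)%:R : rat)^-1)).
  have hom : (6 <= om <= 6 + 12)%N.
    by apply/andP; split; [exact: leq_trans om12 | exact: om18].
  have hQ := sieve_6_12 (qP 12%N om12 isT) nR0 nR5.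
  exact: (sieve_case n0 q4 fR hom isT d0 (two_le_91 rat) hd hQ).
exact: (large_case n1 fR (many_primes (qP 19%N om18 isT) nR0 nR5)).
Qed.

Lemma general_constant (K : realFieldType) (n q : K) :
  n ^+ 6 * (765713%:R / 10%:R ^+ 5) * 10%:R ^+ 18 < q ->
  n ^+ 6 * ((765 * 1000 + 713) * 10 ^+ 13) < q.
Proof. lra. Qed.

Lemma constant_3 (K : realFieldType) (q : K) :
  4426%:R / 10%:R ^+ 3 * 10%:R ^+ 8 < q ->
  (3%:R * (2 ^+ 4) ^+ 2 * (27 + 3901 / 10 ^+ 4)) ^+ 2 <= q.
Proof. lra. Qed.

Lemma constant_4 (K : realFieldType) (q : K) :
  7867%:R / 10%:R ^+ 3 * 10%:R ^+ 8 < q ->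
  (4%:R * (2 ^+ 4) ^+ 2 * (27 + 3901 / 10 ^+ 4)) ^+ 2 <= q.
Proof. lra. Qed.

Lemma constant_5 (K : realFieldType) (q : K) :
  123%:R / 10%:R ^+ 2 * 10%:R ^+ 9 < q ->
  (5%:R * (2 ^+ 4) ^+ 2 * (27 + 3901 / 10 ^+ 4)) ^+ 2 <= q.
Proof. lra. Qed.

Lemma ratr_general (K : realFieldType) (n : nat) :
  ratr (n%:R ^+ 6 * ((765 * 1000 + 713) * 10 ^+ 13)) =
    n%:R ^+ 6 * ((765 * 1000 + 713) * 10 ^+ 13) :> K.
Proof.
have gen (a b c d e : nat) :
    ratr (a%:R ^+ 6 * ((b%:R * c%:R + d%:R) * e%:R ^+ 13)) =
    a%:R ^+ 6 * ((b%:R * c%:R + d%:R) * e%:R ^+ 13) :> K.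
  by rewrite !(rmorphM, rmorphD, rmorphXn) /= !ratr_nat.
exact: gen.
Qed.

Lemma ratr_small (K : realFieldType) (n : nat) :
  ratr ((n%:R * (2 ^+ 4) ^+ 2 * (27 + 3901 / 10 ^+ 4)) ^+ 2) =
    (n%:R * (2 ^+ 4) ^+ 2 * (27 + 3901 / 10 ^+ 4)) ^+ 2 :> K.
Proof.
have gen (a b c d e : nat) :
    ratr ((a%:R * (b%:R ^+ 4) ^+ 2 * (c%:R + d%:R / e%:R ^+ 4)) ^+ 2) =
    (a%:R * (b%:R ^+ 4) ^+ 2 * (c%:R + d%:R / e%:R ^+ 4)) ^+ 2 :> K.
  by rewrite !(rmorphM, rmorphD, rmorphXn, fmorphV) /= !ratr_nat.
exact: gen.
Qed.

Lemma small_valid_C (K : realFieldType) n (C : K) : (1 < n <= 5)%N -> 0 < C ->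
  (forall q : K, C < q -> (n%:R * (2 ^+ 4) ^+ 2 * (27 + 3901 / 10 ^+ 4)) ^+ 2 <= q) ->
  valid_C n C.
Proof.
move=> hn C0 hC; split=> // q pq Cq; split=> // F Fq f fR.
apply: (small_degree_case hn fR).
by rewrite -(ler_rat K) ratr_small ratr_nat Fq; exact: hC.
Qed.

Theorem theorem5p1 (K : realFieldType) :
  (forall n : nat, (2 <= n)%N ->
     valid_C n (n%:R ^+ 6 * (765713%:R / 10%:R ^+ 5) * 10%:R ^+ 18 : K)) /\
  valid_C 3 (4426%:R / 10%:R ^+ 3 * 10%:R ^+ 8 : K) /\
  valid_C 4 (7867%:R / 10%:R ^+ 3 * 10%:R ^+ 8 : K) /\
  valid_C 5 (123%:R / 10%:R ^+ 2 * 10%:R ^+ 9 : K).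
Proof.
split; last first.
  by split; [|split]; apply: small_valid_C => //; [lra | exact: constant_3 | lra | exact:
    constant_4 | lra | exact: constant_5].
move=> n n1; split.
  have n0 : (0 : K) < n%:R ^+ 6 by rewrite exprn_gt0 // ltr0n ltnW.
  by lra.
move=> q pq Cq; split=> // F Fq f fR.
apply: (large_case n1 fR).
by rewrite -(ltr_rat K) ratr_general ratr_nat Fq; exact: general_constant.
Qed.
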